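(* There is a universal constant $K>0$ such that the following holds. Let $n\le m$ be positive integers, let $c:=\frac{m}{n}\ge 1$, and let $Z$ be an $n\times m$ matrix with i.i.d. $N_{\mathbb{C}}(0,1)$ entries. Then for every $p\in\mathbb{N}$ (with $p\ge 1$), $$\mathbf{E}[\mathrm{tr}\,(ZZ^* )^p]\le K\, n^p(\sqrt{c}+1)^{2p}\bigg(1+\frac{2p^2}{c^{3/2}n^2}\bigg)^p\frac{c^{3/4}}{p^{3/2}}.$$
   Context: $N_{\mathbb{C}}(0,1)$ is the law of a complex random variable whose real and imaginary parts are independent real centered Gaussians with variance $\frac12$. For an $n\times n$ matrix $M$, $\mathrm{tr}\,M:=\frac1n\sum_{i=1}^n M_{ii}$ denotes the normalized trace; $M^*$ denotes the adjoint. The constant $K$ does not depend on $n,m,p$. *)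

(* Defs.v *)
From mathcomp Require Export all_boot all_order all_algebra.
From mathcomp Require Export complex.
From mathcomp Require Export all_classical all_reals all_analysis.

Set Implicit Arguments.
Unset Strict Implicit.
Unset Printing Implicit Defensive.

Import Order.TTheory GRing.Theory Num.Theory.
Local Open Scope complex_scope.
Local Open Scope classical_set_scope.
Local Open Scope ring_scope.
Local Open Scope sesquilinear_scope.

Definition ntr {F : fieldType} {n : nat} (M : 'M[F]_n) : F := n%:R^-1 * \tr M.

Definition indep_RV2 {d d1 d2 : measure_display} {T : measurableType d}
    {R : realType} (P : probability T R)
    {T1 : measurableType d1} {T2 : measurableType d2}
    (X : T -> T1) (Y : T -> T2) : Prop :=
  forall (A : set T1) (B : set T2), measurable A -> measurable B ->
    P (X @^-1` A `&` Y @^-1` B) = (P (X @^-1` A) * P (Y @^-1` B))%E.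

Definition mutual_indep_RV {d d' : measure_display} {T : measurableType d}
    {R : realType} (P : probability T R) {T' : measurableType d'}
    {I : finType} (X : I -> T -> T') : Prop :=
  forall (J : {set I}) (B : I -> set T'),
    (forall i, i \in J -> measurable (B i)) ->
    P (\bigcap_(i in [set` J]) X i @^-1` B i) =
    (\prod_(i in J) P (X i @^-1` B i))%E.

(* The second parameter of [normal_prob] is the standard deviation.  Laws are
   compared on measurable sets only, since the values of a measure on other
   sets are meaningless. *)
Definition gaussian_law {d : measure_display} {T : measurableType d}
    {R : realType} (P : probability T R) (mu var : R) (X : {RV P >-> R}) :
    Prop :=
  forall A : set R, measurable A ->
    distribution P X A = normal_prob mu (Num.sqrt var) A.

Definition std_complex_gaussian {d : measure_display} {T : measurableType d}
    {R : realType} (P : probability T R) (z : T -> R[i]) : Prop :=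
  exists X Y : {RV P >-> R},
    [/\ forall w, z w = X w +i* Y w,
        indep_RV2 P X Y,
        gaussian_law 0 (2^-1) X &
        gaussian_law 0 (2^-1) Y].

(* [R[i]] carries no sigma-algebra in the library: it is identified with
   [R * R], so that its Borel sets are those of the product. *)
Definition complex_pair {R : realType} (z : R[i]) : R * R :=
  (complex.Re z, complex.Im z).

Definition complex_ginibre {d : measure_display} {T : measurableType d}
    {R : realType} (P : probability T R) {n m : nat}
    (Z : T -> 'M[R[i]]_(n, m)) : Prop :=
  (forall i j, std_complex_gaussian P (fun w => Z w i j)) /\
  mutual_indep_RV P
    (fun (ij : 'I_n * 'I_m) (w : T) => complex_pair (Z w ij.1 ij.2)).

Definition gram_moment {R : realType} {n m : nat} (Z : 'M[R[i]]_(n, m))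
    (p : nat) : R[i] :=
  ntr ((Z *m Z ^t*) ^+ p).

(* Expectations are available for real random variables only; by this lemma
   nothing is lost when taking the expectation of the real part. *)
Lemma Im_gram_moment {R : realType} {n m : nat} (Z : 'M[R[i]]_(n, m))
    (p : nat) : complex.Im (gram_moment Z p) = 0.
Proof.
have AH : (Z *m Z ^t*) ^t* = Z *m Z ^t*.
  by rewrite trmx_mul map_mxM trmxCK.
have ApH : ((Z *m Z ^t*) ^+ p) ^t* = (Z *m Z ^t*) ^+ p.
  elim: p => [|p IH]; first by rewrite !expr0 trmx1 map_mx1.
  rewrite [X in (X ^t*)]exprS [X in (X ^t*)]/(_ * _) trmx_mul map_mxM IH AH.
  by rewrite exprSr.
have cE : (gram_moment Z p)^* = gram_moment Z p.
  rewrite /gram_moment /ntr rmorphM /= fmorphV rmorph_nat; congr (_ * _).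
  by rewrite -[in RHS]ApH trace_map_mx mxtrace_tr.
by move/eqP: cE; case: (gram_moment Z p) => a b /=;
  rewrite eq_complex /= eqxx /= eq_sym -addr_eq0 -mulr2n mulrn_eq0 => /eqP.
Qed.

(* Main.v *)
(** Gaussian integration by parts gives the loop equations
    E[p_(k+1) w] = E[(sum_(u <= k) tr A^u tr (Z^* Z)^(k-u)) w + Y_k w]
    for the power sums p_k = Tr A^k, A = Z Z^*, where Y_k is the derivation with
    Y_k p_r = r p_(k+r).  Applied to products h_k e_l of complete and elementary
    symmetric functions they close up and determine the expectation of every
    hook Schur function; since p_p is an alternating sum of hooks, E Tr A^p is
    an explicit hypergeometric sum.  Creative telescoping turns it into the
    recurrence of Haagerup and Thorbjornsen
    (p+2) u_(p+1) = (2p+1)(m+n) u_p + (p-1)(p^2 - (m-n)^2) u_(p-1).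
    After normalisation by n^(p+1) (sqrt c + 1)^(2p) this is the recurrence of
    the Marchenko-Pastur moments perturbed by the term p^2 / (n^2 (1+sqrt c)^4).
    The perturbation multiplies the p-th ratio of consecutive moments by at most
    1 + 2 p^2 / (c^(3/2) n^2), and the unperturbed ratio is at most
    1 - (3/2) / (p + tau) with tau = (9/2) sqrt c, whose product decays like
    (sqrt c / p)^(3/2). *)

Require Import Defs.
From mathcomp Require Import -(notations) ssrcomplements mpoly.
From mathcomp Require Import measurable_realfun.
From mathcomp Require Import ring lra.

Set Implicit Arguments.
Unset Strict Implicit.
Unset Printing Implicit Defensive.

Import Order.TTheory GRing.Theory Num.Theory numFieldNormedType.Exports.
Local Open Scope ring_scope.

(** * The three-term recurrence *)

Section MomentRecurrence.

Variables (F : numFieldType) (N M : F).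

(** In closed form [acoef j] is N(N+1)...(N+j) M(M+1)...(M+j) / j! and [bcoef j] is (-1)^j
    (N-1)...(N-j) (M-1)...(M-j) / j!. The quotient [acoef k * bcoef l / (k + l).+1] will be the
    expectation of the signed hook function with arm k and leg l. *)
Fixpoint acoef (j : nat) : F :=
  if j is i.+1 then acoef i * (N + j%:R) * (M + j%:R) / j%:R else N * M.

Fixpoint bcoef (j : nat) : F :=
  if j is i.+1 then - (bcoef i * (N - j%:R) * (M - j%:R) / j%:R) else 1.

Definition wmoment (p : nat) : F :=
  p%:R^-1 * \sum_(j < p) acoef j * bcoef (p.-1 - j).

Lemma wmoment1 : wmoment 1 = N * M.
Proof. by rewrite /wmoment big_ord1 /= invr1 mul1r mulr1. Qed.

(* The summand is hypergeometric in [j]; [G] is its telescoping certificate,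
   as produced by Zeilberger's algorithm. *)
Lemma wmoment_sum_rec (q : nat) :
  let p : F := q.+1%:R in
  let V r := \sum_(j < r) acoef j * bcoef (r.-1 - j) in
  p * (p + 2) * V q.+2 =
    (2 * p + 1) * (p + 1) * (M + N) * V q.+1 +
    p * (p + 1) * (p ^+ 2 - (M - N) ^+ 2) * V q.
Proof.
move=> p V.
pose G (j : nat) := acoef j * (p * (j%:R - (2 * p + 2)) * bcoef (q.+1 - j) +
  bcoef (q - j) * ((p + 1) * ((p - N - M) * (j%:R - 2 * p) - 2 * N * M))).
have S0 (j : nat) : 1 + j%:R != 0 :> F by rewrite nat1r pnatr_eq0.
have G0 : G 0%N = 0.
  by rewrite /G !subn0 /= /p -nat1r; field.
have V2 : V q.+2 = \sum_(j < q) acoef j * bcoef (q.+1 - j)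
    + acoef q * bcoef 1 + acoef q.+1 * bcoef 0.
  by rewrite /V !big_ord_recr /= subnn subSnn.
have V1 : V q.+1 = \sum_(j < q) acoef j * bcoef (q - j) + acoef q * bcoef 0.
  by rewrite /V big_ord_recr /= subnn.
set S2 := \sum_(j < q) _ in V2; set S1 := \sum_(j < q) _ in V1.
(* The range common to the three sums telescopes to [G q]; the last terms of [V q.+2] and [V q.+1]
   are treated apart. *)
have tele : p * (p + 2) * S2 - ((2 * p + 1) * (p + 1) * (M + N) * S1 +
    p * (p + 1) * (p ^+ 2 - (M - N) ^+ 2) * V q) = G q.
  rewrite -[RHS]subr0 -G0 -(telescope_sumr _ (leq0n q)) big_mkord.
  rewrite /S2 /S1 /V !mulr_sumr -big_split -sumrB.
  apply: eq_bigr => -[j /= jq] _.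
  (* Writing q = j + l + 1 removes the truncated subtractions; every [bcoef] then unfolds to
     [bcoef l] times a rational factor. *)
  have [l ql] : exists l, q = (j + l.+1)%N.
    by exists (q - j.+1)%N; rewrite addnS -addSn subnKC.
  rewrite /G; have -> : (q.+1 - j)%N = l.+2 by rewrite ql -addnS addKn.
  have -> : (q - j)%N = l.+1 by rewrite ql addKn.
  have -> : (q.-1 - j)%N = l by rewrite ql addnS addKn.
  have -> : (q.+1 - j.+1)%N = l.+1 by rewrite ql subSS addKn.
  have -> : (q - j.+1)%N = l by rewrite ql addnS subSS addKn.
  have -> : p = j%:R + l%:R + 2 by rewrite /p ql -addnS natrD -addn2 natrD; ring.
  rewrite /= -![_.+2%:R]nat1r -![_.+1%:R]nat1r.
  by field; rewrite !S0 nat1r nat1r pnatr_eq0.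
rewrite V2 V1.
have -> : p * (p + 2) * (S2 + acoef q * bcoef 1 + acoef q.+1 * bcoef 0) =
  G q + (p * (p + 2) * (acoef q * bcoef 1 + acoef q.+1 * bcoef 0)) +
   ((2 * p + 1) * (p + 1) * (M + N) * S1 +
    p * (p + 1) * (p ^+ 2 - (M - N) ^+ 2) * V q) by rewrite -tele; ring.
rewrite /G subnn subSnn /= /p -![_.+1%:R]nat1r.
by field; rewrite S0.
Qed.

Lemma wmoment_rec (q : nat) :
  let p : F := q.+1%:R in
  (p + 2) * wmoment q.+2 = (2 * p + 1) * (M + N) * wmoment q.+1 +
    (p - 1) * (p ^+ 2 - (M - N) ^+ 2) * wmoment q.
Proof.
move=> p; have := wmoment_sum_rec q.
have p1 : p + 1 != 0 by rewrite natr1 pnatr_eq0.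
have p0 : p != 0 by rewrite pnatr_eq0.
(* For r = 0 both sides vanish, so the inverse of 0 in [wmoment] is harmless. *)
have Ve r : \sum_(j < r) acoef j * bcoef (r.-1 - j) = r%:R * wmoment r.
  case: r => [|r]; first by rewrite big_ord0 mul0r.
  by rewrite /wmoment mulrA mulfV ?mul1r// pnatr_eq0.
rewrite /= !Ve -/p => eqV; apply: (mulfI (mulf_neq0 p0 p1)).
have q2 : q.+2%:R = p + 1 :> F by rewrite natr1.
have q0 : q%:R = p - 1 :> F by rewrite /p -natr1 addrK.
rewrite q2 q0 in eqV; rewrite mulrDr; transitivity (p * (p + 2) * ((p + 1) * wmoment q.+2)).
  by ring.
by rewrite eqV; ring.
Qed.

End MomentRecurrence.

(** The trace moment is computed with complex scalars; this brings its value back to the reals. *)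
Lemma rmorph_wmoment (F G : numFieldType) (f : {rmorphism F -> G}) (N M : F) p :
  f (wmoment N M p) = wmoment (f N) (f M) p.
Proof.
have fa j : f (acoef N M j) = acoef (f N) (f M) j.
  by elim: j => [|j IH] /=; rewrite ?fmorph_div !rmorphM ?rmorphD ?IH ?rmorph_nat.
have fb j : f (bcoef N M j) = bcoef (f N) (f M) j.
  elim: j => [|j IH] /=; first by rewrite rmorph1.
  by rewrite rmorphN fmorph_div !rmorphM !rmorphB IH !rmorph_nat.
rewrite /wmoment rmorphM fmorphV rmorph_nat rmorph_sum; congr (_ * _).
by apply: eq_bigr => j _; rewrite rmorphM fa fb.
Qed.

(** * Growth of the solutions *)

Section Growth.

Variables (R : realFieldType) (q eps eta tau : R) (A : nat -> R).

Hypothesis q0 : 0 <= q.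
Hypothesis q1 : q <= 1.
Hypothesis eps0 : 0 <= eps.
Hypothesis eta0 : 0 <= eta.
(** With [eps_eta] the correction factor 1 + eta p^2 reproduces itself in the induction on ratios;
    [tau_large] does the same for the bound 1 - (3/2) / (p + tau) on the free ratios. *)
Hypothesis eps_eta : q * eta + eps <= eta.
Hypothesis tau_large : 3 <= (1 - q) * (tau - 3 / 2).
Hypothesis A1_gt0 : 0 < A 1.
Hypothesis A1_le1 : A 1 <= 1.
Hypothesis A_rec : forall j : nat, let p : R := j.+1%:R in
  (p + 2) * A j.+2 = (p + 1 / 2) * (1 + q) * A j.+1
    + (p - 1) * (eps * p ^+ 2 - q) * A j.

(* The ratios [A j.+2 / A j.+1] of the unperturbed recurrence [eps = 0]. *)
Fixpoint free_ratio (j : nat) : R := if j is i.+1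
  then ((j%:R + 3 / 2) * (1 + q) - j%:R * q / free_ratio i) / (j%:R + 3)
  else (1 + q) / 2.

Let tau_ge : 9 / 2 <= tau.
Proof.
have q1' : 0 <= 1 - q by rewrite subr_ge0.
have [t0|t0] := leP 0 (tau - 3 / 2).
  by have := mulr_ge0 q0 t0; have := tau_large; lra.
by have := mulr_ge0_le0 q1' (ltW t0); have := tau_large; lra.
Qed.

(** For q = 0 the two sides agree. In general the induction step rests on (j + 1)(j + 3) <= (j +
    3/2)(j + 5/2), after which the terms in q cancel. *)
Lemma free_ratio_ge j : (j%:R + 3 / 2) / (j%:R + 3) <= free_ratio j.
Proof.
move: (q0) (q1) (tau_large) (tau_ge) => q0' q1' tau_large' tau_ge'.
elim: j => [|j IH]; first by rewrite /= !add0r; lra.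
have j0 : 0 <= j%:R :> R by [].
have b0 : 0 < free_ratio j by apply: lt_le_trans IH; rewrite divr_gt0//; lra.
rewrite [free_ratio j.+1]/= ler_pM2r ?invr_gt0; last by rewrite -nat1r; lra.
rewrite -nat1r.
have H : (1 + j%:R) * q / free_ratio j
    <= (1 + j%:R) * q * ((j%:R + 3) / (j%:R + 3 / 2)).
  have q2 : 0 <= (1 + j%:R) * q by apply: mulr_ge0 => //; lra.
  apply: (ler_wpM2l q2).
  by rewrite -[leRHS]invrK lef_pV2 ?posrE ?invr_gt0 ?divr_gt0// ?invf_div//; lra.
apply: (le_trans _ (lerB (lexx _) H)).
have -> : (1 + j%:R) * q * ((j%:R + 3) / (j%:R + 3 / 2)) =
  q * ((1 + j%:R) * (j%:R + 3) / (j%:R + 3 / 2)) by ring.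
have : (1 + j%:R) * (j%:R + 3) / (j%:R + 3 / 2) <= 1 + j%:R + 3 / 2 :> R.
  by rewrite ler_pdivrMr; nra.
by nra.
Qed.

Lemma free_ratio_gt0 j : 0 < free_ratio j.
Proof.
by apply: lt_le_trans (free_ratio_ge j); rewrite divr_gt0//;
  have : 0 <= j%:R :> R by []; lra.
Qed.

Lemma free_ratio_le j : free_ratio j <= 1 - 3 / 2 / (j%:R + 1 + tau).
Proof.
move: (q0) (q1) (tau_large) (tau_ge) => q0' q1' tau_large' tau_ge'.
elim: j => [|j IH].
  rewrite /= add0r lerBrDr -lerBrDl ler_pdivrMr; last by lra.
  by nra.
have b0 := free_ratio_gt0 j; have j0 : 0 <= j%:R :> R by [].
have Ie : 1 - 3 / 2 / (j%:R + 1 + tau) = (j%:R + tau - 1 / 2) / (j%:R + 1 + tau).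
  by field; lra.
rewrite Ie in IH.
rewrite [free_ratio j.+1]/= -nat1r ler_pdivrMr; last by lra.
have H : (1 + j%:R) * q * ((j%:R + 1 + tau) / (j%:R + tau - 1 / 2))
    <= (1 + j%:R) * q / free_ratio j.
  have q2 : 0 <= (1 + j%:R) * q by apply: mulr_ge0 => //; lra.
  apply: (ler_wpM2l q2).
  by rewrite -[leLHS]invrK lef_pV2 ?posrE ?invr_gt0 ?divr_gt0// ?invf_div//; lra.
apply: (le_trans (lerB (lexx _) H)); rewrite -subr_ge0.
set t := tau - 3 / 2 in tau_large' *; set y := j%:R + 2 + tau.
(* The factor (t - 1/2)(y - 5/2) - q t y is at least (5/2)(y - t) + 5/4 because (1 - q) t >= 3, and
   y >= t. *)
have -> : (1 - 3 / 2 / (1 + j%:R + 1 + tau)) * (1 + j%:R + 3) -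
  ((1 + j%:R + 3 / 2) * (1 + q) -
   (1 + j%:R) * q * ((j%:R + 1 + tau) / (j%:R + tau - 1 / 2))) =
  3 / 2 * ((t - 1 / 2) * (y - 5 / 2) - q * t * y) / (y * (y - 5 / 2)).
  by rewrite /t /y; field; lra.
apply: divr_ge0; last by rewrite mulr_ge0// /y; lra.
by rewrite mulr_ge0//; rewrite /t /y in tau_large' *; nra.
Qed.

(* The perturbation only increases the ratio, so the term in which the previous
   ratio occurs inverted may be bounded by the free ratio in both directions. *)
Lemma ratio_bounds j : [/\ 0 < A j.+1, free_ratio j * A j.+1 <= A j.+2 &
  A j.+2 <= free_ratio j * (1 + eta * j.+1%:R ^+ 2) * A j.+1].
Proof.
move: (q0) (q1) (tau_large) (tau_ge) => q0' q1' tau_large' tau_ge'.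
elim: j => [|j [a0 lo up]].
  (* At p = 1 the coefficient p - 1 removes [A 0] from the recurrence. *)
  have E : A 2 = free_ratio 0 * A 1.
    by have := A_rec 0; rewrite /=; lra.
  split=> //; first by rewrite E.
  rewrite E -mulrA ler_wpM2l ?(ltW (free_ratio_gt0 0))//.
  by rewrite expr1n mulr1 ler_peMl ?(ltW A1_gt0)// lerDl.
have b0 := free_ratio_gt0 j; have c0 := free_ratio_gt0 j.+1.
have j0 : 0 <= j%:R :> R by [].
have a1 : 0 < A j.+2 by apply: lt_le_trans lo; exact: mulr_gt0.
have /= rec := A_rec j.+1.
set b := free_ratio j in b0 lo up *; set c := free_ratio j.+1 in c0 *.
set p : R := j.+2%:R in rec *.
have pj : p = j%:R + 2 by rewrite /p -!nat1r; ring.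
have pj1 : j.+1%:R = p - 1 by rewrite pj -nat1r; ring.
clearbody p.
have cE : (p + 2) * c = (p + 1 / 2) * (1 + q) - (p - 1) * q / b.
  by rewrite /c /= -/b pj1; field; rewrite gt_eqF//= pj; lra.
(* Up to the factor p - 1, the excess over the free ratio is eps p^2 [A j.+1] plus q times
   [A j.+2 / b - A j.+1], both nonnegative by induction. *)
have dE : (p + 2) * (A j.+3 - c * A j.+2) =
    (p - 1) * ((eps * p ^+ 2 - q) * A j.+1 + q / b * A j.+2).
  by rewrite mulrBr rec [(p + 2) * (c * _)]mulrA cE; ring.
have lo' : A j.+1 <= A j.+2 / b by rewrite ler_pdivlMr// mulrC.
have p1 : 0 <= p - 1 by lra.
split => //.
  rewrite -subr_ge0 -(@pmulr_rge0 _ (p + 2)); last by lra.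
  rewrite dE mulr_ge0// (_ : q / b * A j.+2 = q * (A j.+2 / b)); last by ring.
  have := mulr_ge0 (mulr_ge0 eps0 (sqr_ge0 p)) (ltW a0).
  by have := ler_wpM2l q0 lo'; lra.
rewrite pj1 in up.
have up' : A j.+2 / b <= (1 + eta * (p - 1) ^+ 2) * A j.+1.
  by rewrite ler_pdivrMr// mulrC mulrA.
(* The lower bounds on two consecutive free ratios give (p^2 - 1/4) / (p + 1) >= p - 1; this absorbs
   the factor p - 1 of [dE]. *)
have M : (p - 1) <= (p + 2) * c * b.
  have p2 : 0 <= p + 2 by lra.
  have hc : p + 1 / 2 <= (p + 2) * c.
    have := ler_wpM2l p2 (free_ratio_ge j.+1); rewrite -/c pj1.
    rewrite (_ : (p + 2) * (_ / _) = p + 1 / 2); first by [].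
    by field; rewrite pj; lra.
  have hb : (p - 1 / 2) / (p + 1) <= b.
    have := free_ratio_ge j; rewrite -/b (_ : j%:R + 3 / 2 = p - 1 / 2).
      by rewrite (_ : j%:R + 3 = p + 1)//; lra.
    by lra.
  apply: (@le_trans _ _ ((p + 1 / 2) * ((p - 1 / 2) / (p + 1)))).
    by rewrite mulrA ler_pdivlMr; nra.
  by rewrite ler_pM//; [lra|rewrite divr_ge0//; lra].
rewrite -(@ler_pM2l _ (p + 2)); last by lra.
have -> : (p + 2) * A j.+3 = (p + 2) * (A j.+3 - c * A j.+2) + (p + 2) * c * A j.+2.
  by ring.
rewrite dE.
set x := A j.+2 / b in lo' up'.
have xE : A j.+2 = b * x by rewrite /x mulrCA mulfV ?mulr1// gt_eqF.
have x0 : 0 < x by rewrite divr_gt0.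
rewrite (_ : q / b * A j.+2 = q * x); last by rewrite /x; ring.
have -> : (p + 2) * (c * (1 + eta * p ^+ 2) * A j.+2) =
  ((p + 2) * c * b) * (eta * p ^+ 2) * x + (p + 2) * c * A j.+2.
  by rewrite xE; ring.
rewrite lerD2r; apply: (@le_trans _ _ ((p - 1) * (eta * p ^+ 2) * x)); last first.
  by rewrite ler_pM2r// ler_wpM2r// mulr_ge0// sqr_ge0.
rewrite -mulrA ler_wpM2l//.
apply: (@le_trans _ _ ((eps * p ^+ 2 + q * eta * (p - 1) ^+ 2) * A j.+1)).
  by have := ler_wpM2l q0 up'; lra.
apply: (@le_trans _ _ (eta * p ^+ 2 * A j.+1)); last first.
  by rewrite ler_wpM2l// mulr_ge0// sqr_ge0.
(* What remains is eps p^2 + q eta (p - 1)^2 <= eta p^2: replace p - 1 by p and use [eps_eta]. *)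
rewrite ler_pM2r//.
have h1 : (p - 1) ^+ 2 <= p ^+ 2 by nra.
have h2 : 0 <= q * eta by exact: mulr_ge0.
have := ler_wpM2l h2 h1; have := ler_wpM2r (sqr_ge0 p) eps_eta.
by lra.
Qed.

(** The decay of order 3/2 is put in squared form, so that only integer powers occur. With y = j + 1
    + tau, a free ratio contributes (1 - (3/2) / y)^2 y^3 <= (y - 1)^3, which telescopes; only the
    perturbation factors accumulate. *)
Lemma growth_bound j : A j.+1 ^+ 2 * (j%:R + tau) ^+ 3 <=
  tau ^+ 3 * ((1 + eta * j.+1%:R ^+ 2) ^+ j.+1) ^+ 2.
Proof.
move: (q0) (q1) (tau_large) (tau_ge) => q0' q1' tau_large' tau_ge'.
apply: (@le_trans _ _ (tau ^+ 3 * (\prod_(i < j) (1 + eta * i.+1%:R ^+ 2)) ^+ 2)).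
  elim: j => [|j IH].
    rewrite big_ord0 expr1n mulr1 add0r ler_piMl// ?exprn_ge0//; first by lra.
    by rewrite expr_le1// ltW.
  have [a0 lo up] := ratio_bounds j; have j0 : 0 <= j%:R :> R by [].
  rewrite big_ord_recr /= exprMn [leRHS]mulrA.
  set d := 1 + eta * _ in up *.
  apply: (@le_trans _ _ ((A j.+1 ^+ 2 * (j%:R + tau) ^+ 3) * d ^+ 2)); last first.
    by rewrite ler_wpM2r// sqr_ge0.
  have d0 : 0 <= d by rewrite /d addr_ge0// mulr_ge0// sqr_ge0.
  apply: (@le_trans _ _ ((free_ratio j * d * A j.+1) ^+ 2 * (j.+1%:R + tau) ^+ 3)).
    rewrite ler_wpM2r ?exprn_ge0//; first by rewrite -nat1r; lra.
    rewrite ler_pXn2r// ?nnegrE ?mulr_ge0// ?(ltW (free_ratio_gt0 j))//.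
      by rewrite (le_trans _ lo)// mulr_ge0// ltW// free_ratio_gt0.
    exact: ltW.
  rewrite (_ : _ * _ = (free_ratio j ^+ 2 * (j.+1%:R + tau) ^+ 3) *
    (A j.+1 * d) ^+ 2); last by ring.
  rewrite [leRHS](_ : _ = (j%:R + tau) ^+ 3 * (A j.+1 * d) ^+ 2); last by ring.
  rewrite ler_wpM2r ?sqr_ge0//.
  have y0 : 0 < j.+1%:R + tau by rewrite -nat1r; lra.
  have -> : j%:R + tau = (j.+1%:R + tau) - 1 by rewrite -nat1r; ring.
  set y := j.+1%:R + tau in y0 *.
  have f2 : free_ratio j ^+ 2 <= (1 - 3 / 2 / y) ^+ 2.
    have := free_ratio_le j; rewrite natr1 -/y => fle.
    have f0 := ltW (free_ratio_gt0 j).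
    by rewrite ler_pXn2r// nnegrE (le_trans f0 fle).
  apply: (le_trans (ler_wpM2r _ f2)); first by rewrite exprn_ge0// ltW.
  rewrite (_ : _ * _ = (y - 3 / 2) ^+ 2 * y); last by field; rewrite gt_eqF.
  have y4 : 4 <= y by rewrite /y -nat1r; lra.
  by nra.
rewrite ler_wpM2l ?exprn_ge0//; first by lra.
have d1 i : 1 <= 1 + eta * i.+1%:R ^+ 2 by rewrite lerDl mulr_ge0// sqr_ge0.
have prod0 : 0 <= \prod_(i < j) (1 + eta * i.+1%:R ^+ 2).
  by apply: prodr_ge0 => i _; exact: le_trans (d1 i).
rewrite ler_pXn2r ?nnegrE ?exprn_ge0//; last by exact: le_trans (d1 j).
apply: (@le_trans _ _ ((1 + eta * j.+1%:R ^+ 2) ^+ j)); last first.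
  by rewrite [leRHS]exprS ler_peMl// ?exprn_ge0//; exact: le_trans (d1 j).
rewrite -[X in _ ^+ X]card_ord -prodr_const; apply: ler_prod => i _.
rewrite (le_trans _ (d1 i))//= lerD2l ler_wpM2l//.
by rewrite ler_pXn2r ?nnegrE// ler_nat ltnW// ltnS.
Qed.

End Growth.

(** * The explicit bound for the normalised moments *)

Lemma powR3_2 (R : realType) (x : R) : 0 <= x -> (x `^ (3 / 2)) ^+ 2 = x ^+ 3.
Proof.
move=> x0; rewrite -powR_mulrn ?powR_ge0// -powRrM -powR_mulrn//.
by congr powR; lra.
Qed.

Lemma powR3_4 (R : realType) (x : R) : 0 <= x ->
  (x `^ (3 / 4)) ^+ 2 = x `^ (3 / 2).
Proof.
move=> x0; rewrite -powR_mulrn ?powR_ge0// -powRrM.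
by congr powR; lra.
Qed.

Lemma powR3_2_sqrt (R : realType) (x : R) : 0 <= x ->
  x `^ (3 / 2) = Num.sqrt x ^+ 3.
Proof.
move=> x0; apply/eqP; rewrite -(@eqrXn2 _ 2)// ?powR_ge0 ?exprn_ge0 ?sqrtr_ge0//.
by rewrite powR3_2// -exprM mulnC exprM sqr_sqrtr.
Qed.

Lemma wmoment_bound (R : realType) (n m p : nat) (c : R) :
  c = m%:R / n%:R -> (0 < n)%N -> (n <= m)%N ->
  (0 < p)%N ->
  n%:R^-1 * wmoment n%:R m%:R p <=
    10 * n%:R ^+ p * (Num.sqrt c + 1) ^+ (2 * p) *
    (1 + 2 * p%:R ^+ 2 / (c `^ (3 / 2) * n%:R ^+ 2)) ^+ p *
    (c `^ (3 / 4) / p%:R `^ (3 / 2)).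
Proof.
move=> cE n0 nm; case: p => [//|j] _.
set N : R := n%:R; set s := Num.sqrt c.
have N0 : 0 < N by rewrite ltr0n.
have c1 : 1 <= c by rewrite cE ler_pdivlMr// mul1r ler_nat.
have c0 : 0 <= c by exact: le_trans c1.
have sc : s ^+ 2 = c by rewrite sqr_sqrtr.
have s1 : 1 <= s by rewrite -sqrtr1 ler_sqrt// ltW.
have mE : m%:R = s ^+ 2 * N by rewrite sc cE divfK// gt_eqF.
clearbody N.
have s0 : 0 < s by lra.
have s10 : s + 1 != 0 by rewrite gt_eqF//; lra.
have [sn0 Nn0] : s != 0 /\ N != 0 by split; rewrite gt_eqF.
pose u := (s + 1) ^+ 2.
have u0 : 0 < u by rewrite exprn_gt0//; lra.
(* With this normalisation q is the quotient of the Marchenko-Pastur edges (s - 1)^2 and (s + 1)^2,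
   and eps p^2 is the finite-size term of the recurrence. *)
pose A i := wmoment N (s ^+ 2 * N) i / (N ^+ i.+1 * u ^+ i).
pose q := (s - 1) ^+ 2 / u; pose eps := (N * u) ^- 2.
pose eta := 2 / (s ^+ 3 * N ^+ 2); pose tau := 9 / 2 * s.
have q0 : 0 <= q by rewrite divr_ge0 ?sqr_ge0 ?ltW.
have q1E : 1 - q = 4 * s / u by rewrite /q /u; field.
have q1 : q <= 1 by rewrite -subr_ge0 q1E; apply: divr_ge0 (ltW u0); apply: mulr_ge0 (ltW s0).
have eps0 : 0 <= eps by rewrite invr_ge0 sqr_ge0.
have d0 : 0 < s ^+ 3 * N ^+ 2 by rewrite mulr_gt0 ?exprn_gt0.
have eta0 : 0 <= eta by rewrite divr_ge0 ?(ltW d0).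
(* By [q1E] this amounts to s^2 <= 8 u. *)
have e_e : q * eta + eps <= eta.
  rewrite addrC -lerBrDr -{1}[eta]mul1r -mulrBl q1E /eps /eta -subr_ge0.
  rewrite (_ : _ - _ = (8 * u - s ^+ 2) / (s ^+ 2 * N ^+ 2 * u ^+ 2)).
    by rewrite divr_ge0 ?mulr_ge0 ?exprn_ge0 ?ltW// /u; nra.
  by rewrite /u; field; rewrite s10 Nn0 sn0.
(* This amounts to 15 s^2 - 12 s - 3 >= 0, an equality at s = 1, so 9/2 is the least possible factor
   in [tau]. *)
have tau3 : 3 <= (1 - q) * (tau - 3 / 2).
  rewrite q1E mulrAC ler_pdivlMr// /tau /u.
  have := mulr_ge0 (ltW s0) (ltW s0).
  by nra.
have A1 : A 1%N = s ^+ 2 / u.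
  by rewrite /A wmoment1 /u; field; rewrite s10 Nn0.
have A10 : 0 < A 1%N by rewrite A1 divr_gt0// exprn_gt0.
have A11 : A 1%N <= 1 by rewrite A1 ler_pdivrMr// mul1r /u; nra.
have Arec i : let p : R := i.+1%:R in (p + 2) * A i.+2 =
    (p + 1 / 2) * (1 + q) * A i.+1 + (p - 1) * (eps * p ^+ 2 - q) * A i.
  move=> p; have := wmoment_rec N (s ^+ 2 * N) i; rewrite -/p => /= E.
  rewrite /A mulrA E /q /eps.
  rewrite [N ^+ i.+3]exprS [N ^+ i.+2]exprS [u ^+ i.+2]exprS [u ^+ i.+1]exprS /u.
  field; rewrite s10 Nn0 !expf_neq0//.
have := growth_bound q0 q1 eps0 eta0 e_e tau3 A10 A11 Arec j.
set p : R := j.+1%:R; set E := (1 + eta * p ^+ 2) ^+ j.+1 => G.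
have p1 : 1 <= p by rewrite ler1n.
have AE : N^-1 * wmoment N m%:R j.+1 = N ^+ j.+1 * (s + 1) ^+ (2 * j.+1) * A j.+1.
  rewrite mE exprM /A -/u [N ^+ j.+2]exprS; field.
  by rewrite Nn0 !expf_neq0//.
rewrite AE; clearbody A.
have -> : 1 + 2 * p ^+ 2 / (c `^ (3 / 2) * N ^+ 2) = 1 + eta * p ^+ 2.
  by rewrite powR3_2_sqrt// /eta; congr (_ + _); rewrite mulrAC.
rewrite -/E -!mulrA [10 * _]mulrCA ler_pM2l ?exprn_gt0//.
rewrite [10 * _]mulrCA ler_pM2l ?exprn_gt0//; last by lra.
have E0 : 0 <= E by rewrite exprn_ge0// addr_ge0// mulr_ge0// sqr_ge0.
have [a0 _ _] := ratio_bounds q0 q1 eps0 eta0 e_e tau3 A10 Arec j.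
have pp0 : 0 < p `^ (3 / 2) by rewrite powR_gt0; lra.
rewrite -(@ler_pXn2r _ 2) ?nnegrE ?(ltW a0)//; last first.
  by rewrite !mulr_ge0// ?invr_ge0 ?powR_ge0.
clearbody E; rewrite !exprMn exprVn powR3_2 ?powR3_4// ?powR3_2_sqrt//.
rewrite -/s.
have t0 : 0 < j%:R + tau by rewrite ltr_wpDl// mulr_gt0.
have -> : 10 ^+ 2 * (E ^+ 2 * (s ^+ 3 / p ^+ 3)) = (100 * s ^+ 3 * E ^+ 2) / p ^+ 3.
  by field; lra.
rewrite ler_pdivlMr ?exprn_gt0//.
apply: (@le_trans _ _ (A j.+1 ^+ 2 * (j%:R + tau) ^+ 3)).
  rewrite ler_wpM2l ?sqr_ge0// ler_pXn2r ?nnegrE ?(ltW t0)//.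
  by rewrite /p -natr1 lerD2l /tau; lra.
apply: (le_trans G); rewrite ler_wpM2r ?sqr_ge0//.
(* The constant 10 suffices since (9/2)^3 = 91.125 <= 10^2. *)
rewrite /tau exprMn ler_pM2r ?exprn_gt0//; lra.
Qed.

(** * Newton identities and loop equations *)

Section Convolution.

Variable S : comNzRingType.
Implicit Types f g h : nat -> S.

(** Sequences stand for formal power series: [conv] is the Cauchy product and [theta] the Euler
    derivation x d/dx. *)
Definition conv f g (k : nat) : S := \sum_(i < k.+1) f i * g (k - i)%N.

Definition theta f (k : nat) : S := k%:R * f k.

(** Truncation to polynomials transfers commutativity and associativity from the polynomial ring. *)
Lemma conv_coef n f g k : (k < n)%N ->
  conv f g k = ((\poly_(i < n) f i) * (\poly_(i < n) g i))`_k.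
Proof.
move=> kn; rewrite coefM; apply: eq_bigr => -[i /= ik] _.
by rewrite !coef_poly (leq_ltn_trans (ltnSE ik) kn) (leq_ltn_trans (leq_subr _ _) kn).
Qed.

Lemma convC f g : conv f g = conv g f.
Proof.
by apply/funext => k; rewrite !(conv_coef _ _ (ltnSn k)) mulrC.
Qed.

Lemma convA f g h : conv f (conv g h) = conv (conv f g) h.
Proof.
apply/funext => k; have kk := ltnSn k.
pose p (u : nat -> S) := \poly_(i < k.+1) u i.
have key u v w : conv u (conv v w) k = (p u * (p v * p w))`_k.
  rewrite coefM; apply: eq_bigr => -[i /= ik] _.
  by rewrite coef_poly ik (conv_coef _ _ (leq_ltn_trans (leq_subr i k) kk)).
by rewrite key convC key mulrA mulrC.
Qed.

Lemma convNl f h : conv (\- f) h = \- conv f h.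
Proof.
by apply/funext => k; rewrite /conv /= -sumrN; apply: eq_bigr => i _; exact: mulNr.
Qed.

Lemma convNr f h : conv f (\- h) = \- conv f h.
Proof. by rewrite convC convNl convC. Qed.

Lemma convBr f g h : conv f (g \- h) = conv f g \- conv f h.
Proof.
apply/funext => k; rewrite /conv /= -sumrB; apply: eq_bigr => i _.
exact: mulrBr.
Qed.

Lemma theta_conv f g : theta (conv f g) = conv (theta f) g \+ conv f (theta g).
Proof.
apply/funext => k; rewrite /theta /conv /= mulr_sumr -big_split.
apply: eq_bigr => -[i /= ik] _.
by rewrite -{1}(subnKC (ltnSE ik)) natrD; ring.
Qed.

Lemma conv_recl f g k : f 0%N = 0 ->
  conv f g k.+1 = \sum_(i < k.+1) f i.+1 * g (k - i)%N.
Proof.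
move=> f0; rewrite /conv big_ord_recl f0 mul0r add0r.
by apply: eq_bigr => i _; rewrite lift0.
Qed.

(** An index s equals (i + j).+1 for exactly s pairs (i, j). *)
Lemma sum_triangle f p :
  \sum_(i < p) \sum_(j < p - i) f (i + j).+1 = \sum_(s < p.+1) s%:R * f s.
Proof.
elim: p f => [|p IH] f; first by rewrite big_ord0 big_ord1 mul0r.
rewrite big_ord_recl subn0.
rewrite [X in _ + X](eq_bigr (fun i : 'I_p => \sum_(j < p - i) f (i + j).+2));
  last by [].
rewrite (IH (fun s => f s.+1)) [RHS]big_ord_recl mul0r add0r -big_split.
by apply: eq_bigr => i _ /=; rewrite -nat1r mulrDl mul1r.
Qed.

Lemma conv1r f : conv f (fun k => (k == 0)%:R) = f.
Proof.
apply/funext => k; rewrite /conv big_ord_recr /= subnn mulr1 big1 ?add0r//.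
by move=> [i /= ik] _; rewrite subn_eq0 leqNgt ik mulr0.
Qed.

Lemma conv1l f : conv (fun k => (k == 0)%:R) f = f.
Proof. by rewrite convC conv1r. Qed.

End Convolution.

Section Newton.

Variables (F : numFieldType) (S : comAlgType F).
Implicit Types P h y : nat -> S.

(** Formally h = exp(sum_k P_k x^k / k): for power sums P this is the generating series of the
    complete symmetric functions, for -P that of the signed elementary ones. *)
Definition newton P h := h 0%N = 1 /\ theta h = conv P h.

Lemma natr_inj_alg (k : nat) (x y : S) : k.+1%:R * x = k.+1%:R * y -> x = y.
Proof.
rewrite !mulr_natl -[x *+ _](scaler_nat (R := F)) -[y *+ _](scaler_nat (R := F)).
by apply: (@scalerI F S); rewrite pnatr_eq0.
Qed.

Lemma newton_ex P : P 0%N = 0 -> exists h, newton P h.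
Proof.
move=> P0.
(* [s k] lists h_k, ..., h_0, newest first, since the recursion needs all earlier terms. *)
pose fix s (k : nat) : seq S := if k is l.+1 then
  (k%:R^-1 : F) *: (\sum_(i < l.+1) P i.+1 * (s l)`_i) :: s l else [:: 1].
pose h k := (s k)`_0.
have hE k i : (i <= k)%N -> (s k)`_i = h (k - i)%N.
  by elim: k i => [|k IH] [|i] //= ik; rewrite IH.
exists h; split=> //; apply/funext => -[|k].
  by rewrite /theta /conv big_ord1 P0 !mul0r.
rewrite conv_recl// /theta /h [s k.+1]/= [(_ :: _)`_0]/= mulr_natl -scaler_nat.
rewrite scalerA divff ?pnatr_eq0// scale1r; apply: eq_bigr => -[i ik] _ /=.
by rewrite hE.
Qed.

Lemma newton_uniq0 P y : P 0%N = 0 -> y 0%N = 0 -> theta y = conv P y ->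
  y = fun=> 0.
Proof.
move=> P0 y0 yP; apply/funext; elim/ltn_ind => -[//|k IH].
apply: (@natr_inj_alg k); rewrite mulr0.
rewrite -[LHS]/(theta y k.+1) yP conv_recl// big1// => -[i /= ik] _.
by rewrite IH ?mulr0// ltnS leq_subr.
Qed.

(** The product is killed by [theta], hence constant: exp(f) exp(-f) = 1. *)
Lemma newton_opp P h e : newton P h -> newton (\- P) e ->
  conv h e = fun k => (k == 0)%:R.
Proof.
move=> [h0 hP] [e0 eP].
have : theta (conv h e) = fun=> 0.
  rewrite theta_conv hP eP convNl convNr [conv h (conv _ _)]convA [conv h P]convC.
  by apply/funext => k /=; rewrite subrr.
move=> T0; apply/funext => -[|k]; first by rewrite /conv big_ord1 h0 e0 mul1r.
by apply: (@natr_inj_alg k); rewrite mulr0; have := congr1 (@^~ k.+1) T0.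
Qed.

Lemma newton_power_sum P h e : newton P h -> newton (\- P) e ->
  conv (theta h) e = P.
Proof.
move=> hP eP; have he := newton_opp hP eP.
by have [_ ->] := hP; rewrite -convA he conv1r.
Qed.

Section Derivation.

Variable Y : S -> S.
Hypothesis YD : {morph Y : u v / u + v}.
Hypothesis YM : forall u v, Y (u * v) = Y u * v + u * Y v.

Lemma deriv0 : Y 0 = 0.
Proof. by apply: (@addrI _ (Y 0)); rewrite -YD !addr0. Qed.

Lemma deriv1 : Y 1 = 0.
Proof. by apply: (@addrI _ (Y 1)); rewrite -[in RHS](mul1r 1) YM mul1r mulr1 addr0. Qed.

Lemma derivMn k x : Y (k%:R * x) = k%:R * Y x.
Proof.
elim: k => [|k IH]; first by rewrite !mul0r deriv0.
by rewrite -!nat1r !mulrDl YD IH !mul1r.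
Qed.

Lemma deriv_sum I (r : seq I) (E : I -> S) :
  Y (\sum_(i <- r) E i) = \sum_(i <- r) Y (E i).
Proof. exact: (big_morph Y YD deriv0). Qed.

(** Formally h = exp(g) with [theta g = P], so Y h = Y(g) h, and Y(g) = xi. The two sides are
    compared through uniqueness for the equation [theta y = conv P y]. *)
Lemma deriv_newton P h xi : P 0%N = 0 -> newton P h -> xi 0%N = 0 ->
  Y \o P = theta xi -> Y \o h = conv xi h.
Proof.
move=> P0 [h0 hP] xi0 YP.
have YC f g : Y \o conv f g = conv (Y \o f) g \+ conv f (Y \o g).
  apply/funext => k; rewrite /conv /= deriv_sum -big_split.
  by apply: eq_bigr => i _; exact: YM.
suff : (Y \o h \- conv xi h) = fun=> 0.
  by move=> E; apply/funext => k; apply/eqP; rewrite -subr_eq0 -[_ - _]/((_ \- _) k) E.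
apply: (@newton_uniq0 P) => //.
  by rewrite /= h0 deriv1 /conv big_ord1 xi0 mul0r subrr.
have tY : theta (Y \o h) = Y \o theta h.
  by apply/funext => k; rewrite /theta /= derivMn.
transitivity (theta (Y \o h) \- theta (conv xi h)).
  by apply/funext => k; rewrite /theta /= mulrBr.
rewrite convBr tY hP YC YP theta_conv hP !convA [conv xi P]convC.
by apply/funext => k /=; rewrite opprD addrACA subrr add0r.
Qed.

End Derivation.
End Newton.

(** * Expectations of hook functions from the loop equations *)

Section LoopEquations.

Variables (F : numFieldType) (S : comAlgType F).
Variables (N M : F) (P : nat -> S) (Y : nat -> S -> S) (L : S -> F).

Hypothesis P0 : P 0%N = 0.
Hypothesis YD : forall i, {morph Y i : u v / u + v}.
Hypothesis YM : forall i u v, Y i (u * v) = Y i u * v + u * Y i v.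
Hypothesis YP : forall i r, Y i (P r.+1) = r.+1%:R * P (i + r.+1)%N.
Hypothesis LD : {morph L : u v / u + v}.
Hypothesis LZ : forall (c : F) u, L (c *: u) = c * L u.
Hypothesis L1 : L 1 = 1.
Hypothesis loop : forall i w, L (P i.+1 * w) =
  L ((conv P P i + (N + M) *: P i + (N * M * (i == 0)%:R) *: 1) * w + Y i w).

Let L0 : L 0 = 0. Proof. by rewrite -(scale0r 0) LZ mul0r. Qed.

Let LN u : L (- u) = - L u. Proof. by rewrite -scaleN1r LZ mulN1r. Qed.

Let LB u v : L (u - v) = L u - L v. Proof. by rewrite LD LN. Qed.

Let LMn (k : nat) u : L (k%:R * u) = k%:R * L u.
Proof. by rewrite mulr_natl -scaler_nat LZ. Qed.

Let Lsum I (r : seq I) (E : I -> S) :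
  L (\sum_(i <- r) E i) = \sum_(i <- r) L (E i).
Proof. exact: (big_morph L LD L0). Qed.

Variables h e : nat -> S.
Hypothesis hP : newton P h.
Hypothesis eP : newton (\- P) e.

(** The value at r = 0 is 0 and not [P i], as [deriv_newton] asks; [theta] does not see it. *)
Let xi (i r : nat) : S := if r is 0 then 0 else P (i + r)%N.

Let theta_xi i : Y i \o P = theta (xi i).
Proof.
apply/funext => -[|r]; last by rewrite /= YP.
by rewrite /= P0 (deriv0 (@YD i)) /theta mul0r.
Qed.

Let Yh i : Y i \o h = conv (xi i) h.
Proof. exact: (deriv_newton (@YD i) (@YM i) P0 hP _ (theta_xi i)). Qed.

Let YN i u : Y i (- u) = - Y i u.
Proof.
by apply: (@addrI _ (Y i u)); rewrite -YD !subrr; exact: (deriv0 (@YD i)).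
Qed.

Let Ye i : Y i \o e = \- conv (xi i) e.
Proof.
rewrite -convNl; apply: (deriv_newton (@YD i) (@YM i) _ eP).
- by rewrite /= P0 oppr0.
- by rewrite /= oppr0.
- apply/funext => r; have /= := congr1 (@^~ r) (theta_xi i).
  by rewrite /theta YN => ->; rewrite mulrN.
Qed.

(* Up to sign, the Schur function of a hook: [P], [h] and [e] play the roles of
   the power sums, the complete and the signed elementary symmetric functions. *)
Let hook (k l : nat) : S := \sum_(j < l.+1) h (k + j)%N * e (l - j)%N.

(** Pieri's rule for a row times a column, in signed form. *)
Let hook_rec k l : h k * e l.+1 = hook k l.+1 - hook k.+1 l.
Proof.
rewrite /hook big_ord_recl addn0 subn0.
rewrite [X in _ + X - _](eq_bigr (fun j : 'I_l.+1 => h (k.+1 + j)%N * e (l - j)%N)).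
  by rewrite addrK.
by move=> j _; rewrite addSnnS subSS.
Qed.

Let hook0l k : hook k 0 = h k.
Proof. by rewrite /hook big_ord1 addn0 eP.1 mulr1. Qed.

Let hook0 l : hook 0 l.+1 = 0.
Proof. by have := congr1 (@^~ l.+1) (newton_opp hP eP). Qed.

(** [mixed k.+1 l] is minus the sum of [h (k - i) * Y i (e l.+1)] over i <= k, the extra term in the
    equation for [h k.+1 * e l.+1]. *)
Let mixed (k l : nat) : S :=
  \sum_(i < k) \sum_(r < l.+1) h (k.-1 - i)%N * e (l - r)%N * P (i + r).+1.

(* Shifting one step from [e] to [h] turns [mixed k l] into [mixed k.+1 l.-1]
   up to two boundary sums, which Newton's identities evaluate. *)
Let mixedE k l : mixed k l = (k + l)%:R * hook k l.
Proof.
elim: l k => [|l IH] k.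
  rewrite hook0l addn0 -[RHS]/(theta h k) hP.2 /mixed; case: k => [|k].
    by rewrite big_ord0 /conv big_ord1 P0 mul0r.
  rewrite conv_recl//; apply: eq_bigr => i _.
  by rewrite big_ord1 eP.1 mulr1 addn0 mulrC.
have hE : \sum_(i < k) h (k.-1 - i)%N * P i.+1 = k%:R * h k.
  rewrite -[RHS]/(theta h k) hP.2; case: k => [|k].
    by rewrite big_ord0 /conv big_ord1 P0 mul0r.
  by rewrite conv_recl//; apply: eq_bigr => i _; exact: mulrC.
have eE : \sum_(r < l.+1) e (l - r)%N * P r.+1 = - (l.+1%:R * e l.+1).
  rewrite -[l.+1%:R * _]/(theta e l.+1) eP.2 convNl /= opprK conv_recl//.
  by apply: eq_bigr => i _; exact: mulrC.
have -> : mixed k l.+1 = k%:R * h k * e l.+1 + \sum_(i < k) \sum_(r < l.+1)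
     h (k.-1 - i)%N * e (l - r)%N * P (i + r).+2.
  rewrite /mixed -hE mulr_suml -big_split; apply: eq_bigr => i _ /=.
  rewrite big_ord_recl addn0 subn0 mulrAC; congr (_ + _).
  by apply: eq_bigr => r _; rewrite subSS addnS.
have -> : \sum_(i < k) \sum_(r < l.+1) h (k.-1 - i)%N * e (l - r)%N * P (i + r).+2
    = mixed k.+1 l + l.+1%:R * h k * e l.+1.
  rewrite /mixed big_ord_recl /= subn0.
  under [\sum_(i < l.+1) _]eq_bigr do rewrite -mulrA add0n.
  rewrite -mulr_sumr eE mulrN mulrCA -mulrA addrAC addNr add0r.
  apply: eq_bigr => i _; apply: eq_bigr => r _.
  by rewrite addSn; case: k i {hE} => [[]|k i].
by rewrite IH addSnnS; move: (hook_rec k l) => E; rewrite -!mulrA E natrD; ring.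
Qed.

(** The left side collects the terms [Y i] of h_(k-i); each product P_s h_(k-s) arises from s pairs
    of indices. *)
Let sum_conv_xi k : \sum_(i < k.+1) conv (xi i) h (k - i)%N = conv (theta P) h k.
Proof.
rewrite [RHS](eq_bigr (fun s : 'I_k.+1 => s%:R * (P s * h (k - s)%N))); last first.
  by move=> s _; rewrite mulrA.
rewrite -(sum_triangle (fun s => P s * h (k - s)%N)).
rewrite big_ord_recr /= subnn /conv big_ord1 /= mul0r addr0.
apply: eq_bigr => -[i /= ik] _; rewrite big_ord_recl /= mul0r add0r.
by apply: eq_bigr => j _; rewrite /= addnS -subnDA -addnS.
Qed.

(** Newton's identity expands (k+1) h_(k+1) into the products P_(i+1) h_(k-i), and [loop] applies to
    each P_(i+1). Since P P h = theta^2 h - (theta P) h, the terms (theta P) h cancel and k^2 + (N +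
    M) k + N M = (N + k)(M + k) remains. *)
Let Lh_gen k w : k.+1%:R * L (h k.+1 * w) =
  (N + k%:R) * (M + k%:R) * L (h k * w)
    + L (\sum_(i < k.+1) h (k - i)%N * Y i w).
Proof.
rewrite -LMn mulrA -[k.+1%:R * h _]/(theta h k.+1) hP.2 conv_recl// mulr_suml Lsum.
rewrite (eq_bigr (fun i : 'I_k.+1 => L (((conv P P i * h (k - i)%N
   + (N + M) *: (P i * h (k - i)%N)) + (N * M) *: ((i == 0%N :> nat)%:R * h (k - i)%N)
   + conv (xi i) h (k - i)%N) * w + h (k - i)%N * Y i w))); last first.
  move=> i _; rewrite -mulrA loop YM -[Y i (h _)]/((Y i \o h) _) Yh; congr L.
  by rewrite -scalerA scaler_nat !mulrDl -!scalerAl !mulrA mulr_natl addrA; ring.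
rewrite -Lsum big_split LD; congr (_ + _); rewrite -LZ.
rewrite -mulr_suml !big_split /= -!scaler_sumr sum_conv_xi.
rewrite -/(conv (conv P P) h k) -/(conv P h k).
rewrite -/(conv (fun i => (i == 0%N)%:R) h k) conv1l.
rewrite -[conv (conv _ _) _]convA -hP.2.
have T : conv P (theta h) k = k%:R * (k%:R * h k) - conv (theta P) h k.
  have := congr1 (@^~ k) (theta_conv P h); rewrite -hP.2 /= => E.
  by rewrite -[k%:R * (k%:R * _)]/(theta (theta h) k) E addrAC subrr add0r.
rewrite T; congr L; rewrite [RHS]scalerAl; congr (_ * _).
rewrite addrC !addrA [_ + k%:R * _]addrC addrK /theta.
have natZ u : k%:R * u = (k%:R : F) *: u by rewrite mulr_natl scaler_nat.
rewrite !natZ !scalerA -!scalerDl; congr (_ *: _).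
by rewrite /GRing.scale /=; ring.
Qed.

Let Lh_rec k : k.+1%:R * L (h k.+1) = (N + k%:R) * (M + k%:R) * L (h k).
Proof.
have := Lh_gen k 1; rewrite !mulr1 big1 ?L0 ?addr0// => i _.
by rewrite (deriv1 (@YM i)) mulr0.
Qed.

Let Lhe_rec k l : k.+1%:R * L (h k.+1 * e l.+1) =
  (N + k%:R) * (M + k%:R) * L (h k * e l.+1)
    - (k + l.+1)%:R * L (hook k.+1 l).
Proof.
rewrite Lh_gen; congr (_ + _); rewrite -addSnnS -LMn -mixedE -LN; congr L.
rewrite /mixed -sumrN; apply: eq_bigr => i _.
rewrite -[Y i (e _)]/((Y i \o e) _) Ye /= conv_recl// mulrN mulr_sumr.
by congr (- _); apply: eq_bigr => r _; rewrite mulrA mulrAC /= addnS.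
Qed.

(** Through [hook_rec], [Lhe_rec] expresses [hook k.+1 l.+1] by [hook k l.+1] and by hooks with
    second index l, so induction on l and then on k determines them all; it starts at
    [hook 0 l.+1 = 0]. *)
Let Lhook k l : L (hook k.+1 l) = acoef N M k * bcoef N M l / (k + l).+1%:R.
Proof.
elim: l k => [|l IHl].
  elim=> [|k IHk].
    have := Lh_rec 0; rewrite !hook0l hP.1 L1 mul1r => ->.
    by rewrite !addr0 invr1 !mulr1.
  rewrite hook0l; apply: (@mulfI _ k.+2%:R); first by rewrite pnatr_eq0.
  rewrite Lh_rec -hook0l IHk /= !addn0 !mulr1 -!nat1r.
  by field; rewrite !nat1r !pnatr_eq0.
elim=> [|k IHk].
  have := Lhe_rec 0 l; rewrite !hook_rec !LB hook0 L0 !IHl => E.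
  have -> : L (hook 1 l.+1) = 1 * (L (hook 1 l.+1) - acoef N M 1 * bcoef N M l / (1 + l).+1%:R) + acoef N M 1 * bcoef N M l / (1 + l).+1%:R by ring.
  rewrite E /= -!nat1r.
  by field; rewrite !nat1r !pnatr_eq0.
have := Lhe_rec k.+1 l; rewrite !hook_rec !LB IHk !IHl => E.
apply: (@mulfI _ k.+2%:R); first by rewrite pnatr_eq0.
rewrite -[LHS](subrK (k.+2%:R * (acoef N M k.+2 * bcoef N M l / (k.+2 + l).+1%:R))).
rewrite -mulrBr E /= !addSn !addnS -!nat1r !natrD.
by field; rewrite -!natrD !nat1r !pnatr_eq0.
Qed.

(* By Newton's identities [P p] is the sum of all [hook i.+1 (p.-1 - i)]. *)
Lemma loop_moment p : L (P p.+1) = wmoment N M p.+1.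
Proof.
rewrite /wmoment mulr_sumr -(newton_power_sum hP eP).
transitivity (L (\sum_(i < p.+1) hook i.+1 (p - i))); last first.
  rewrite Lsum; apply: eq_bigr => -[i /= ip] _.
  by rewrite Lhook subnKC// mulrC.
rewrite /conv /theta; congr L.
rewrite (eq_bigr (fun s : 'I_p.+2 => s%:R * (h s * e (p.+1 - s)%N))); last first.
  by move=> s _; rewrite mulrA.
rewrite -(sum_triangle (fun s => h s * e (p.+1 - s)%N)).
apply: eq_bigr => -[i /= ip] _; rewrite /hook subSn//.
by apply: eq_bigr => j _; rewrite addSn subSS subnDA.
Qed.

End LoopEquations.

(** * Loop equations of a Gaussian matrix over an abstract algebra *)

Section GaussianMatrix.

Variables (F : numFieldType) (S : comAlgType F) (n m : nat).
Variables (Z : 'M[S]_(n, m)) (Zs : 'M[S]_(m, n)).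
Variables (D : 'I_n -> 'I_m -> S -> S) (L : S -> F).

(** [D i j] models the Wirtinger derivative in the entry (i, j), for which the adjoint [Zs] is
    constant. [LIBP] is then integration by parts for entries of law N_C(0,1). *)
Hypothesis DD : forall i j, {morph D i j : u v / u + v}.
Hypothesis DM : forall i j u v, D i j (u * v) = D i j u * v + u * D i j v.
Hypothesis DZ : forall i j a b, D i j (Z a b) = ((a == i) && (b == j))%:R.
Hypothesis DZs : forall i j b a, D i j (Zs b a) = 0.
Hypothesis LD : {morph L : u v / u + v}.
Hypothesis LZ : forall (c : F) u, L (c *: u) = c * L u.
Hypothesis L1 : L 1 = 1.
Hypothesis LIBP : forall i j u, L (Zs j i * u) = L (D i j u).

Let A := Z *m Zs.
Let B := Zs *m Z.

Let AS k : A ^+ k.+1 = A *m A ^+ k. Proof. by rewrite exprS mulmxE. Qed.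
Let BS k : B ^+ k.+1 = B *m B ^+ k. Proof. by rewrite exprS mulmxE. Qed.

Let AZ k : A ^+ k *m Z = Z *m B ^+ k.
Proof.
elim: k => [|k IH]; first by rewrite !expr0 mul1mx mulmx1.
by rewrite AS BS -mulmxA IH /A /B !mulmxA.
Qed.

Let BZs k : B ^+ k *m Zs = Zs *m A ^+ k.
Proof.
elim: k => [|k IH]; first by rewrite !expr0 mul1mx mulmx1.
by rewrite AS BS -mulmxA IH /A /B !mulmxA.
Qed.

Let D_sum i j I (r : seq I) (E : I -> S) :
  D i j (\sum_(x <- r) E x) = \sum_(x <- r) D i j (E x).
Proof. exact: (big_morph (D i j) (@DD i j) (deriv0 (@DD i j))). Qed.

(** Leibniz rule: removing one of the k + 1 factors Z of (Z Zs)^k Z leaves A^u on its left and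
    B^(k-u) on its right. *)
Let D_AZ i j k a b : D i j ((A ^+ k *m Z) a b) =
  \sum_(u < k.+1) (A ^+ u) a i * (B ^+ (k - u)) j b.
Proof.
elim: k a b => [|k IH] a b.
  by rewrite big_ord1 !expr0 mul1mx DZ !mxE -natrM mulnb [j == b]eq_sym.
have -> : A ^+ k.+1 *m Z = Z *m (Zs *m (A ^+ k *m Z)).
  by rewrite AS !mulmxA.
rewrite mxE D_sum.
rewrite (eq_bigr (fun c => ((a == i) && (c == j))%:R * (Zs *m (A ^+ k *m Z)) c b
   + Z a c * \sum_d Zs c d * D i j ((A ^+ k *m Z) d b))); last first.
  move=> c _; rewrite DM DZ; congr (_ + _ * _); rewrite mxE D_sum.
  by apply: eq_bigr => d _; rewrite DM DZs mul0r add0r.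
rewrite big_split big_ord_recl; congr (_ + _).
  rewrite (bigD1 j)//= big1 ?addr0; last first.
    by move=> c /negbTE ->; rewrite andbF mul0r.
  by rewrite eqxx andbT expr0 [X in _ = X * _]mxE subn0 AZ mulmxA -/B -BS.
transitivity (\sum_c \sum_d \sum_(u < k.+1)
    Z a c * Zs c d * (A ^+ u) d i * (B ^+ (k - u)) j b).
  apply: eq_bigr => c _; rewrite mulr_sumr; apply: eq_bigr => d _.
  by rewrite IH !mulr_sumr; apply: eq_bigr => u _; rewrite !mulrA.
under eq_bigr do rewrite exchange_big.
rewrite exchange_big /=; apply: eq_bigr => u _; rewrite /bump /= add1n subSS.
rewrite AS /A -mulmxA [in RHS]mxE mulr_suml; apply: eq_bigr => c _.
rewrite [in RHS]mxE mulr_sumr mulr_suml.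
by apply: eq_bigr => d _; rewrite !mulrA.
Qed.

(** Newton's identities need the power sum of index 0 to be 0 instead of n; the traces n of [A ^+ 0]
    and m of [B ^+ 0] come back in [conv_tr]. *)
Definition trpow (k : nat) : S := if k is 0 then 0 else \tr (A ^+ k).

Let trpowS k : trpow k.+1 = \sum_i \sum_j (A ^+ k *m Z) i j * Zs j i.
Proof.
rewrite /trpow exprSr -mulmxE /A mulmxA.
by apply: eq_bigr => i _; rewrite mxE.
Qed.

(** By [BZs] the r + 1 terms of the Leibniz rule are all equal. *)
Let D_trpow i j r : D i j (trpow r.+1) = r.+1%:R * (Zs *m A ^+ r) j i.
Proof.
rewrite trpowS D_sum.
transitivity (\sum_(u < r.+1) (B ^+ (r - u) *m Zs *m A ^+ u) j i).
  transitivity (\sum_a \sum_b \sum_(u < r.+1)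
     (B ^+ (r - u)) j b * Zs b a * (A ^+ u) a i).
    apply: eq_bigr => a _; rewrite D_sum; apply: eq_bigr => b _.
    rewrite DM DZs mulr0 addr0 D_AZ mulr_suml; apply: eq_bigr => u _.
    by rewrite mulrC mulrA mulrC mulrA.
  under eq_bigr do rewrite exchange_big.
  rewrite exchange_big /=; apply: eq_bigr => u _; rewrite [in RHS]mxE.
  by apply: eq_bigr => a _; rewrite [in RHS]mxE mulr_suml.
rewrite (eq_bigr (fun=> (Zs *m A ^+ r) j i)).
  by rewrite sumr_const card_ord mulr_natl.
by move=> u _; rewrite BZs -mulmxA mulmxE -exprD subnK// -ltnS.
Qed.

(* [Y k] is the derivation that sends [Z] to [(Z Zs)^k Z]. *)
Let Y (k : nat) (u : S) : S := \sum_i \sum_j (A ^+ k *m Z) i j * D i j u.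

Let YD k : {morph Y k : u v / u + v}.
Proof.
move=> u v; rewrite /Y -big_split; apply: eq_bigr => i _.
by rewrite -big_split; apply: eq_bigr => j _; rewrite DD mulrDr.
Qed.

Let YM k u v : Y k (u * v) = Y k u * v + u * Y k v.
Proof.
rewrite /Y mulr_suml mulr_sumr -big_split; apply: eq_bigr => i _.
rewrite mulr_suml mulr_sumr -big_split; apply: eq_bigr => j _.
by rewrite DM /=; ring.
Qed.

Let Y_trpow k r : Y k (trpow r.+1) = r.+1%:R * trpow (k + r.+1)%N.
Proof.
rewrite addnS /trpow (_ : A ^+ (k + r).+1 = (A ^+ k *m Z) *m (Zs *m A ^+ r)).
  rewrite /mxtrace mulr_sumr; apply: eq_bigr => i _.
  rewrite mxE mulr_sumr; apply: eq_bigr => j _.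
  by rewrite -[\sum_i _]/(trpow r.+1) D_trpow mulrCA.
by rewrite -addnS exprD exprS -!mulmxE !mulmxA.
Qed.

Let trA k : \tr (A ^+ k) = trpow k + n%:R * (k == 0)%:R.
Proof.
by case: k => [|k]; rewrite /trpow ?expr0 ?mxtrace1 ?add0r ?mulr1// mulr0 addr0.
Qed.

Let trB k : \tr (B ^+ k) = trpow k + m%:R * (k == 0)%:R.
Proof.
case: k => [|k]; rewrite /trpow ?expr0 ?mxtrace1 ?add0r ?mulr1// mulr0 addr0.
by rewrite BS /B -mulmxA -AZ mulmxA mxtrace_mulC mulmxA -/A -AS.
Qed.

Let L0 : L 0 = 0. Proof. by rewrite -(scale0r 0) LZ mul0r. Qed.

Let Lsum I (r : seq I) (E : I -> S) :
  L (\sum_(i <- r) E i) = \sum_(i <- r) L (E i).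
Proof. exact: (big_morph L LD L0). Qed.

Let conv_tr k : conv (fun u => \tr (A ^+ u)) (fun u => \tr (B ^+ u)) k =
  conv trpow trpow k + (n%:R + m%:R : F) *: trpow k
    + (n%:R * m%:R * (k == 0)%:R : F) *: 1.
Proof.
rewrite /conv (eq_bigr (fun u : 'I_k.+1 => trpow u * trpow (k - u)%N +
   m%:R * (trpow u * (k - u == 0)%N%:R) + n%:R * ((u == 0 :> nat)%:R * trpow (k - u)%N)
   + n%:R * m%:R * ((u == 0 :> nat)%:R * (k - u == 0)%N%:R))); last first.
  by move=> u _; rewrite trA trB; ring.
rewrite !big_split -!mulr_sumr /=.
rewrite -/(conv trpow (fun i => (i == 0)%:R) k).
rewrite -/(conv (fun i => (i == 0)%:R) trpow k).
rewrite -/(conv (fun i => (i == 0)%:R) (fun i => (i == 0)%:R) k).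
have natZ a (u : S) : a%:R * u = (a%:R : F) *: u by rewrite mulr_natl scaler_nat.
have deltaE : (k == 0)%:R = ((k == 0)%:R : F) *: 1 :> S by rewrite scaler_nat.
rewrite !conv1l conv1r deltaE -!mulrA !natZ scalerDl !scalerA.
by rewrite [X in X + _ = _]addrAC !mulrA !addrA.
Qed.

(** Integration by parts in the last factor [Zs] of the trace: differentiating [A ^+ k *m Z] yields
    the products of traces of A^u and B^(k-u), differentiating w yields [Y k w]. *)
Let loop k w : L (trpow k.+1 * w) = L ((conv trpow trpow k +
  (n%:R + m%:R : F) *: trpow k + (n%:R * m%:R * (k == 0)%:R) *: 1) * w + Y k w).
Proof.
rewrite -conv_tr trpowS mulr_suml Lsum.
transitivity (\sum_i \sum_j L (D i j ((A ^+ k *m Z) i j) * w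
    + (A ^+ k *m Z) i j * D i j w)).
  apply: eq_bigr => i _; rewrite mulr_suml Lsum; apply: eq_bigr => j _.
  by rewrite mulrAC mulrC LIBP DM.
under eq_bigr do rewrite -Lsum.
rewrite -Lsum; congr L; under eq_bigr do rewrite big_split.
rewrite big_split; congr (_ + _); under eq_bigr do rewrite -mulr_suml.
rewrite -mulr_suml; congr (_ * _).
under eq_bigr do under eq_bigr do rewrite D_AZ.
under eq_bigr do rewrite exchange_big.
rewrite exchange_big; apply: eq_bigr => u _ /=; rewrite /mxtrace mulr_suml.
by apply: eq_bigr => i _; rewrite mulr_sumr.
Qed.

Theorem gaussian_trace_moment p :
  L (\tr ((Z *m Zs) ^+ p.+1)) = wmoment n%:R m%:R p.+1.
Proof.
have [h hP] := newton_ex (erefl : trpow 0 = 0).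
have N0 : (\- trpow)%R 0%N = 0 by rewrite /= oppr0.
have [e eP] := newton_ex N0.
by rewrite -(loop_moment erefl YD YM Y_trpow LD LZ L1 loop hP eP).
Qed.

End GaussianMatrix.

(** * Moments of the Gaussian law *)

Section WeightedTransfer.
Local Open Scope classical_set_scope.
Local Open Scope ereal_scope.
Import HBNNSimple.

Context {d d' : measure_display} {T : measurableType d}
  {T' : measurableType d'} {R : realType}.
Variables (mu : {measure set T -> \bar R}) (nu : probability T' R).
Variables (W : T -> R) (U : T -> T') (w : R).

Hypothesis iW : mu.-integrable setT (EFin \o W).
Hypothesis mU : measurable_fun setT U.
(** The image under [U] of the measure with density [W] is w times [nu]. This serves for a Gaussian
    density, with U the identity, and for independence, with W built from the other factors. *)
Hypothesis transfer_indic : forall B, measurable B ->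
  \int[mu]_x (W x * \1_B (U x))%:E = w%:E * nu B.

Let mW : measurable_fun setT W.
Proof. by have /integrableP[/measurable_EFinP] := iW. Qed.

Let integrable_weighted_indic B : measurable B ->
  mu.-integrable setT (fun x => (W x * \1_B (U x))%:E).
Proof.
move=> mB; apply: le_integrable iW => //.
  apply/measurable_EFinP/measurable_funM => //.
  exact: (measurableT_comp (measurable_indic mB)).
move=> x _ /=; rewrite lee_fin normrM ler_piMr// indicE.
by case: (_ \in _); rewrite ?normr1 ?normr0.
Qed.

Lemma transfer_nnsfun (g : {nnsfun T' >-> R}) :
  \int[mu]_x (W x * g (U x))%:E = w%:E * \int[nu]_y (g y)%:E.
Proof.
pose s := fset_set (range g).
have sfin : finite_set (range g) by [].
under eq_integral => x _ do
  rewrite fimfunE fsbig_finite// mulr_sumr -sumEFin.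
rewrite integral_sum//; last first.
  move=> r; rewrite (_ : (fun x => _) =
      (fun x => r%:E * (W x * \1_(g @^-1` [set r]) (U x))%:E)).
    apply: integrableZl => //; apply: integrable_weighted_indic.
    exact: measurable_sfunP.
  by apply/funext => x; rewrite mulrCA EFinM.
rewrite integralT_nnsfun sintegralE fsbig_finite// fin_num_sume_distrr//; last first.
  move=> i j _ _; apply: fin_num_adde_defr.
  by rewrite fin_numM// fin_num_measure//; exact: measurable_sfunP.
apply: eq_bigr => r _.
have mr : measurable (g @^-1` [set r]) by exact: measurable_sfunP.
under eq_integral do rewrite mulrCA EFinM.
by rewrite (integralZl measurableT (integrable_weighted_indic mr)) transfer_indic// muleCA.
Qed.

(** Monotone convergence asks for no integrability of f, so this version can be used to prove it. *)
Lemma transfer_ge0 (f : T' -> R) : (forall x, (0 <= W x)%R) -> (0 <= w)%R ->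
  measurable_fun setT f -> (forall y, (0 <= f y)%R) ->
  \int[mu]_x (W x * f (U x))%:E = w%:E * \int[nu]_y (f y)%:E.
Proof.
move=> W0 w0 mf f0.
have mEf : measurable_fun setT (EFin \o f) by exact/measurable_EFinP.
pose g := nnsfun_approx measurableT mEf.
have gf y : (fun n => (g n y)%:E) @ \oo --> (f y)%:E.
  by apply: cvg_nnsfun_approx => // z _; rewrite lee_fin.
have ndg y : {homo (fun n => g n y) : m n / (m <= n)%N >-> (m <= n)%R}.
  by move=> m n mn; exact/lefP/nd_nnsfun_approx.
have mgU n : measurable_fun setT (fun x => (W x * g n (U x))%:E).
  apply/measurable_EFinP/measurable_funM => //.
  exact: (measurableT_comp _ mU).
transitivity (limn (fun n => \int[mu]_x (W x * g n (U x))%:E)).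
  rewrite -monotone_convergence//.
  - apply: eq_integral => x _; apply/esym/cvg_lim => //.
    under eq_fun do rewrite EFinM; rewrite EFinM.
    by apply: cvgeZl => //; exact: gf.
  - by move=> n x _; rewrite lee_fin mulr_ge0.
  - by move=> x _ m n mn; rewrite lee_fin ler_wpM2l// ndg.
under eq_fun do rewrite transfer_nnsfun.
rewrite limeMl//.
  congr (_ * _); rewrite -monotone_convergence//.
  - by apply: eq_integral => y _; apply/cvg_lim => //; exact: gf.
  - by move=> n; exact/measurable_EFinP.
  - by move=> n x _; rewrite lee_fin.
  - by move=> x _ m n mn; rewrite lee_fin ndg.
apply: ereal_nondecreasing_is_cvgn => m n mn; apply: ge0_le_integral => //.
- by move=> x _; rewrite lee_fin.
- exact/measurable_EFinP.
- exact/measurable_EFinP.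
- by move=> x _; rewrite lee_fin ndg.
Qed.

Let transfer_ge0_integrable (f : T' -> R) : (forall y, (0 <= f y)%R) ->
  nu.-integrable setT (EFin \o f) ->
  mu.-integrable setT (fun x => (W x * f (U x))%:E) ->
  \int[mu]_x (W x * f (U x))%:E = w%:E * \int[nu]_y (f y)%:E.
Proof.
move=> f0 if_ iWf.
have mEf : measurable_fun setT (EFin \o f) by case/integrableP: if_.
pose g := nnsfun_approx measurableT mEf.
have gf y : (fun n => (g n y)%:E) @ \oo --> (f y)%:E.
  by apply: cvg_nnsfun_approx => // z _; rewrite lee_fin.
have ndg y : {homo (fun n => g n y) : m n / (m <= n)%N >-> (m <= n)%R}.
  by move=> m n mn; exact/lefP/nd_nnsfun_approx.
have glef n y : (g n y <= f y)%R.
  rewrite -lee_fin; have /cvg_lim <- // := gf y.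
  apply: lime_ge; first by apply/cvg_ex; exists (f y)%:E; exact: gf.
  by exists n => // k /= nk; rewrite lee_fin ndg.
have mgU n : measurable_fun setT (fun x => (W x * g n (U x))%:E).
  apply/measurable_EFinP/measurable_funM => //.
  exact: (measurableT_comp _ mU).
have [_ _ c1] : [/\ mu.-integrable setT (fun x => (W x * f (U x))%:E),
    [sequence \int[mu]_x `|(W x * g n (U x))%:E - (W x * f (U x))%:E|]_n @ \oo --> 0 &
    [sequence \int[mu]_x (W x * g n (U x))%:E]_n @ \oo -->
    \int[mu]_x (W x * f (U x))%:E].
  apply: (@dominated_convergence _ _ _ mu setT measurableT
    (fun n x => (W x * g n (U x))%:E) _ (fun x => `|(W x * f (U x))%:E|)) => //.
  - by case/integrableP: iWf.
  - apply: aeW => x _; under eq_fun do rewrite EFinM; rewrite EFinM.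
    by apply: cvgeZl => //; exact: gf.
  - exact: integrable_abse.
  - apply: aeW => x n _; rewrite /= lee_fin !normrM ler_wpM2l//.
    by rewrite !ger0_norm.
have [_ _ c2] : [/\ nu.-integrable setT (EFin \o f),
    [sequence \int[nu]_x `|(g n x)%:E - (f x)%:E|]_n @ \oo --> 0 &
    [sequence \int[nu]_x (g n x)%:E]_n @ \oo --> \int[nu]_x (f x)%:E].
  apply: (@dominated_convergence _ _ _ nu setT measurableT
    (fun n x => (g n x)%:E) _ (EFin \o f)) => //.
  - by move=> n; exact/measurable_EFinP.
  - by apply: aeW => x _; exact: gf.
  - by apply: aeW => x n _; rewrite /= lee_fin ger0_norm.
have c3 : [sequence \int[mu]_x (W x * g n (U x))%:E]_n @ \oo -->
    w%:E * \int[nu]_y (f y)%:E.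
  under eq_fun do rewrite transfer_nnsfun.
  by apply: cvgeZl.
exact: (cvg_unique _ c1 c3).
Qed.

Lemma transfer_integrable (f : T' -> R) :
  nu.-integrable setT (EFin \o f) ->
  mu.-integrable setT (fun x => (W x * f (U x))%:E) ->
  \int[mu]_x (W x * f (U x))%:E = w%:E * \int[nu]_y (f y)%:E.
Proof.
move=> if_ iWf.
have mf : measurable_fun setT f by case/integrableP: if_ => /measurable_EFinP.
(* The decomposition f = (|f| + f) - |f| into nonnegative integrable functions. *)
pose fp y := (`|f y| + f y)%R; pose fm y := `|f y|%R.
have ifm : nu.-integrable setT (EFin \o fm) by exact: integrable_norm.
have ifp : nu.-integrable setT (EFin \o fp).
  rewrite (_ : EFin \o fp = (EFin \o fm) \+ (EFin \o f)) //.
  exact: integrableD.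
have iWfm : mu.-integrable setT (fun x => (W x * fm (U x))%:E).
  apply: le_integrable iWf => //.
    apply/measurable_EFinP/measurable_funM => //.
    apply: measurableT_comp => //; exact: measurableT_comp.
  by move=> x _ /=; rewrite lee_fin !normrM normr_id.
have iWfp : mu.-integrable setT (fun x => (W x * fp (U x))%:E).
  rewrite (_ : (fun x => _) = (fun x => (W x * fm (U x))%:E) \+
    (fun x => (W x * f (U x))%:E)); first exact: integrableD.
  by apply/funext => x; rewrite /fp mulrDr.
have fp0 y : (0 <= fp y)%R by rewrite /fp -lerBlDr sub0r -normrN ler_norm.
have E1 := transfer_ge0_integrable fp0 ifp iWfp.
have E2 := transfer_ge0_integrable (fun y => normr_ge0 (f y)) ifm iWfm.
transitivity (\int[mu]_x ((W x * fp (U x))%:E - (W x * fm (U x))%:E)).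
  by apply: eq_integral => x _; rewrite -EFinB -mulrBr /fp /fm addrAC subrr add0r.
have finm : \int[nu]_y (fm y)%:E \is a fin_num.
  exact: (integrable_fin_num measurableT ifm).
rewrite integralB// E1 E2 -muleBr//; last first.
  by apply: fin_num_adde_defl; rewrite fin_numN.
rewrite -integralB//; congr (_ * _); apply: eq_integral => y _.
by rewrite /= -EFinB /fp /fm addrAC subrr add0r.
Qed.

End WeightedTransfer.

Section NormalMoments.
Local Open Scope classical_set_scope.
Context {R : realType}.
Let mu := @lebesgue_measure R.

(** The fundamental theorem of calculus on growing symmetric intervals, nondegenerate thanks to
    [n.+1], followed by dominated convergence. *)
Lemma integral_derive0 (F f : R -> R) :
  (forall x : R, is_derive x (1 : R) F (f x)) -> continuous f ->
  mu.-integrable setT (EFin \o f) ->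
  F n%:R @[n --> \oo] --> (0 : R) -> F (- n%:R) @[n --> \oo] --> (0 : R) ->
  (\int[mu]_x (f x)%:E = 0)%E.
Proof.
move=> dF cf if_ Fp Fn.
pose D (n : nat) : set R := `[- n.+1%:R, n.+1%:R].
have ftc n : (\int[mu]_(x in D n) (f x)%:E = (F n.+1%:R - F (- n.+1%:R))%:E)%E.
  rewrite (@continuous_FTC2 _ f F)// ?EFinB//.
  - by rewrite -subr_gt0 opprK -natrD ltr0n.
  - exact: continuous_subspaceT.
  - have cF : continuous F.
      by move=> x; apply/differentiable_continuous/derivable1_diffP; case: (dF x).
    split.
    + by move=> x _; case: (dF x).
    + exact/cvg_at_right_filter/cF.
    + exact/cvg_at_left_filter/cF.
  - by move=> x _; rewrite derive1E; exact: derive_val.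
have c1 : (\int[mu]_(x in D n) (f x)%:E @[n --> \oo] --> 0)%E.
  under eq_fun do rewrite ftc.
  apply: cvg_EFin; first exact: nearW.
  rewrite -[X in _ --> X](subrr (0 : R)); apply: cvgB.
    by rewrite (cvg_shiftS (fun n : nat => F n%:R)).
  by rewrite (cvg_shiftS (fun n : nat => F (- n%:R))).
have [_ _ c2] : [/\ mu.-integrable setT (EFin \o f),
   ([sequence \int[mu]_x `|((EFin \o f) \_ (D n)) x - (f x)%:E|]_n @ \oo --> 0)%E &
   ([sequence \int[mu]_x ((EFin \o f) \_ (D n)) x]_n @ \oo --> \int[mu]_x (f x)%:E)%E].
  apply: (@dominated_convergence _ _ _ mu setT measurableT
    (fun n => (EFin \o f) \_ (D n)) _ (fun x => `|(f x)%:E|%E)) => //.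
  - move=> n; have mD : measurable (D n) by exact: measurable_itv.
    apply: (measurable_restrictT (EFin \o f) mD).1.
    by apply: measurable_funTS; case/integrableP: if_.
  - by case/integrableP: if_.
  - apply: aeW => x _; apply: cvg_near_cst.
    near=> n; rewrite patchE mem_set// /D /= in_itv /=.
    rewrite -ler_norml; near: n.
    exists (Num.trunc `|x|).+1 => // n /= xn.
    rewrite (le_trans (ltW (truncnS_gt _)))// ler_nat.
    exact: leq_trans xn (leqnSn _).
  - exact: integrable_abse.
  - apply: aeW => x n _; rewrite patchE; case: ifPn => // _.
    by rewrite abse0.
have c3 : (\int[mu]_(x in D n) (f x)%:E @[n --> \oo] --> \int[mu]_x (f x)%:E)%E.
  by under eq_fun do rewrite integral_mkcond.
exact: (cvg_unique _ c3 c1).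
Unshelve. all: by end_near. Qed.

End NormalMoments.

Section HalfNormalMoments.
Local Open Scope classical_set_scope.
Context {R : realType}.
Let mu := @lebesgue_measure R.
Let s : R := Num.sqrt 2^-1.
Let phi (x : R) := normal_pdf 0 s x.

Let phiE x : phi x = normal_peak s * expR (- x ^+ 2).
Proof.
rewrite /phi normal_pdfE; last by rewrite gt_eqF ?sqrtr_gt0.
rewrite /normal_fun subr0.
by rewrite sqr_sqrtr// -mulr_natr mulVf ?divr1.
Qed.

Let s0 : s != 0. Proof. by rewrite gt_eqF// sqrtr_gt0. Qed.

Let peak0 : 0 <= normal_peak s. Proof. exact: normal_peak_ge0. Qed.

(** Half of the exponent in exp(-x^2) absorbs the power of x; the other half gives a standard
    Gaussian density, which is integrable and bounded. *)
Let phi_moment_le (k : nat) : exists2 C, 0 <= C & forall x : R,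
  `|phi x * x ^+ k| <= C * normal_pdf 0 1 x.
Proof.
have p1 : 0 < normal_peak (1 : R) by exact: normal_peak_gt0.
(* From |x|^k <= 1 + (x^2)^(k+1) and y^(k+1) / (k+1)! <= exp(y) at y = x^2 / 2. *)
pose B : R := 1 + 2 ^+ k.+1 * k.+1`!%:R.
have B0 : 0 <= B by rewrite addr_ge0// mulr_ge0// exprn_ge0.
exists (normal_peak s * B / normal_peak 1) => [|x].
  by rewrite divr_ge0 ?mulr_ge0// ltW.
have expk : `|x| ^+ k <= B * expR (x ^+ 2 / 2).
  have y0 : 0 <= x ^+ 2 / 2 by rewrite divr_ge0 ?sqr_ge0.
  have f0 : 0 < k.+1`!%:R :> R by rewrite ltr0n fact_gt0.
  have h := expR_ge1Dxn k y0.
  have h2 : (x ^+ 2) ^+ k.+1 <= 2 ^+ k.+1 * k.+1`!%:R * expR (x ^+ 2 / 2).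
    have d0 : 0 < 2 ^+ k.+1 * k.+1`!%:R :> R by rewrite mulr_gt0// exprn_gt0.
    rewrite -ler_pdivrMl//.
    apply: le_trans h; rewrite ler_wpDl// expr_div_n invfM mulrC mulrA.
    by rewrite mulrAC.
  have h1 : 1 <= expR (x ^+ 2 / 2) by rewrite -[leLHS]expR0 ler_expR.
  have hx : `|x| ^+ k <= 1 + (x ^+ 2) ^+ k.+1.
    rewrite -real_normK ?num_real// -exprM; have [x1|x1] := leP `|x| 1.
      by rewrite (@le_trans _ _ 1) ?exprn_ile1// lerDl exprn_ge0.
    rewrite ler_wpDl// ler_weXn2l// ?(ltW x1)//.
    by rewrite mul2n -addnn (leq_trans (leqnSn k))// leq_addr.
  apply: (le_trans hx); rewrite /B mulrDl mul1r lerD//.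
rewrite normrM ger0_norm ?normal_pdf_ge0// normrX phiE.
rewrite normal_pdfE// /normal_fun subr0 expr1n.
have pn0 : normal_peak (1 : R) != 0 by rewrite gt_eqF.
rewrite [leRHS](_ : _ = normal_peak s * (B * expR (- x ^+ 2 / 2))); last by field.
rewrite -mulrA ler_wpM2l//.
have -> : expR (- x ^+ 2) = expR (- x ^+ 2 / 2) / expR (x ^+ 2 / 2).
  by rewrite -expRN -expRD; congr expR; lra.
rewrite mulrAC ler_pdivrMr ?expR_gt0// [leRHS]mulrAC [leRHS]mulrC.
by rewrite ler_wpM2l ?expR_ge0.
Qed.


Lemma integrable_phi_moment k :
  mu.-integrable setT (fun x => (phi x * x ^+ k)%:E).
Proof.
have [C C0 hC] := phi_moment_le k.
apply: (le_integrable measurableT _ _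
  (integrableZl measurableT C (integrable_normal_pdf 0 1))).
  apply/measurable_EFinP/measurable_funM; first exact: measurable_normal_pdf.
  exact: measurable_funX.
move=> x _; rewrite /= lee_fin (le_trans (hC x))//.
by rewrite ler_norm.
Qed.

(** The bound of order k + 1 leaves a factor 1 / |u n|. A general sequence u covers both ends of the
    line. *)
Let phi_moment_cvg (k : nat) (u : nat -> R) : (forall n : nat, n%:R <= `|u n|) ->
  phi (u n) * u n ^+ k @[n --> \oo] --> (0 : R).
Proof.
move=> hu; have [C C0 hC] := phi_moment_le k.+1.
pose B := C * normal_peak 1.
apply/cvgrPdist_le => e e0; near=> n.
have n0 : 0 < n%:R :> R by rewrite ltr0n; near: n; exact: nbhs_infty_gt.
rewrite sub0r normrN.
have un0 : 0 < `|u n| by exact: lt_le_trans (hu n).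
rewrite -(ler_pM2r un0) -normrM -mulrA -exprSr (le_trans (hC _))//.
apply: (@le_trans _ _ B).
  by rewrite ler_wpM2l// normal_pdf_ub.
rewrite (@le_trans _ _ (e * n%:R)) ?ler_pM2l//.
rewrite -ler_pdivrMl// mulrC; near: n; exact: nbhs_infty_ger.
Unshelve. all: by end_near. Qed.


Let is_derive_phi_moment (k : nat) (x : R) :
  is_derive x (1 : R) (fun x => phi x * x ^+ k)
   (k%:R * (phi x * x ^+ k.-1) - 2 * (phi x * x ^+ k.+1)).
Proof.
have dX : is_derive x (1 : R) (fun y : R => y ^+ k) (k%:R * x ^+ k.-1).
  have := @is_deriveX R R id k x 1 1 (is_derive_id x 1).
  by rewrite exprfctE scaler1.
have dE : is_derive x (1 : R) (fun y : R => expR (- y ^+ 2))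
    (expR (- x ^+ 2) * - (2 * x)).
  apply: (@is_derive1_comp _ expR (fun y : R => - y ^+ 2)).
  by apply: is_derive_eq; rewrite -[_%:A]mulr1 /GRing.scale /=; ring.
have -> : (fun x => phi x * x ^+ k) =
    normal_peak s \*: ((fun y : R => expR (- y ^+ 2)) * (fun y : R => y ^+ k)).
  by apply/funext => y; rewrite phiE /= -mulrA.
apply: is_derive_eq; rewrite phiE /GRing.scale /=.
case: k dX => [|k] _ /=; rewrite ?mul0r ?mulr0 ?add0r ?addr0 ?exprS; ring.
Qed.

(** The moments of a centered Gaussian of variance 1/2: (k-1)!! / 2^(k/2) for even k and 0 for odd
    k. *)
Fixpoint half_normal_moment (k : nat) : R :=
  match k with
  | 0 => 1
  | 1 => 0
  | (l.+1 as k').+1 => k'%:R / 2 * half_normal_moment l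
  end.

(** The derivative of phi x^k has integral 0. At k = 0 the factor k annihilates the term in
    [k.-1]. *)
Let phi_moment_rec k :
  (\int[mu]_x (phi x * x ^+ k.+1)%:E =
   (k%:R / 2)%:E * \int[mu]_x (phi x * x ^+ k.-1)%:E)%E.
Proof.
have iint j (a : R) : mu.-integrable setT (fun x => (a * (phi x * x ^+ j))%:E).
  under eq_fun do rewrite EFinM.
  by apply: integrableZl => //; exact: integrable_phi_moment.
have : (\int[mu]_x (k%:R * (phi x * x ^+ k.-1) - 2 * (phi x * x ^+ k.+1))%:E = 0)%E.
  apply: (integral_derive0 (is_derive_phi_moment k)).
  - have cphi j : continuous (fun x => phi x * x ^+ j).
      move=> x; apply: (@continuousM _ _ phi (fun y => y ^+ j)).
        exact: (continuous_normal_pdf s0).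
      exact: (@exprn_continuous R j x).
    by move=> x; apply: cvgB; (apply: cvgM; [exact: cvg_cst|exact: cphi]).
  - rewrite (_ : EFin \o _ = (fun x => (k%:R * (phi x * x ^+ k.-1))%:E) \-
      (fun x => (2 * (phi x * x ^+ k.+1))%:E))%E.
      by apply: integrableB => //; exact: iint.
    by apply/funext => x /=; rewrite EFinB.
  - by apply: phi_moment_cvg => n; rewrite normr_nat.
  - by apply: phi_moment_cvg => n; rewrite normrN normr_nat.
under eq_integral do rewrite EFinB.
rewrite (integralB measurableT (iint k.-1 k%:R) (iint k.+1 2)).
under eq_integral do rewrite EFinM.
rewrite integralZl//; last exact: integrable_phi_moment.
under [X in (_ - X)%E]eq_integral do rewrite EFinM.
rewrite integralZl//; last exact: integrable_phi_moment.
have fin j : (\int[mu]_x (phi x * x ^+ j)%:E)%E \is a fin_num.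
  exact: (integrable_fin_num measurableT (integrable_phi_moment j)).
rewrite -(fineK (fin k.-1)) -(fineK (fin k.+1)) -!EFinM -EFinB => -[E].
by congr EFin; lra.
Qed.


Lemma integral_phi_moment k :
  (\int[mu]_x (phi x * x ^+ k)%:E = (half_normal_moment k)%:E)%E.
Proof.
elim/ltn_ind: k => -[_|[_|k IH]].
- under eq_integral do rewrite expr0 mulr1.
  by rewrite integral_normal_pdf.
- by rewrite phi_moment_rec mul0r mul0e.
- by rewrite phi_moment_rec /= IH.
Qed.

End HalfNormalMoments.

Section GaussianMoments.
Local Open Scope classical_set_scope.
Context {d : measure_display} {T : measurableType d} {R : realType}.
Variables (P : probability T R) (X : {RV P >-> R}).
Hypothesis gX : gaussian_law 0 2^-1 X.
Let mu := @lebesgue_measure R.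
Let phi (x : R) := normal_pdf 0 (Num.sqrt 2^-1) x.

Let phi_transfer (B : set R) : measurable B ->
  (\int[mu]_x (phi x * \1_B (id x))%:E = 1%:E * distribution P X B)%E.
Proof.
move=> mB; rewrite mul1e gX// /normal_prob [RHS]integral_mkcond.
apply: eq_integral => x _; rewrite patchE indicE.
by case: (x \in B); rewrite ?mulr1 ?mulr0.
Qed.

(** Inherited from Lebesgue measure through [transfer_ge0], applied to |x^k|. *)
Let integrable_law k :
  (distribution P X).-integrable setT (EFin \o (fun x : R => x ^+ k)).
Proof.
apply/integrableP; split; first exact/measurable_EFinP.
rewrite -[ltLHS]mul1e.
have mn : measurable_fun [set: R] (fun x : R => `|x ^+ k|).
  exact: measurableT_comp.
have := transfer_ge0 (nu := distribution P X) (w := 1)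
  (integrable_normal_pdf 0 (Num.sqrt 2^-1))
  (@measurable_id _ _ setT) phi_transfer (normal_pdf_ge0 _ _) ler01 mn (fun=> normr_ge0 _).
rewrite [RHS]/= => <-.
have /integrableP[_] := integrable_phi_moment k (R := R).
apply: le_lt_trans; rewrite le_eqVlt; apply/orP; left; apply/eqP.
apply: eq_integral => x _.
by rewrite /= normrM ger0_norm ?normal_pdf_ge0.
Qed.

Lemma gaussian_moment k :
  P.-integrable setT (EFin \o (fun w => X w ^+ k)) /\
  (\int[P]_w (X w ^+ k)%:E = (half_normal_moment k)%:E)%E.
Proof.
have iX : P.-integrable setT (EFin \o (fun w => X w ^+ k)).
  apply/integrableP; split.
    by apply/measurable_EFinP; apply: measurable_funX.
  have /integrableP[m] := integrable_law k.
  by rewrite ge0_integral_distribution//; exact: measurableT_comp.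
split => //.
rewrite -(integral_distribution (f := EFin \o (fun x : R => x ^+ k)))//; last first.
  exact/measurable_EFinP.
rewrite -[LHS]mul1e -integral_phi_moment.
rewrite -(transfer_integrable (nu := distribution P X) (w := 1)
  (integrable_normal_pdf 0 (Num.sqrt 2^-1))
  (@measurable_id _ _ setT) phi_transfer (integrable_law k))//.
exact: integrable_phi_moment.
Qed.

End GaussianMoments.

(** * Expectations of products of independent variables *)

Section HasMoments.
Local Open Scope classical_set_scope.
Context {d : measure_display} {T : measurableType d} {R : realType}.
Variable P : probability T R.
Implicit Types X Y : T -> R.

(** Unlike integrability, having all moments is stable under products, so every monomial in the
    entries stays integrable. *)
Definition has_moments X := measurable_fun setT X /\
  forall k, P.-integrable setT (EFin \o (fun w => X w ^+ k)).

Lemma has_moments_integrable X : has_moments X ->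
  P.-integrable setT (EFin \o X).
Proof. by case=> _ /(_ 1%N). Qed.

Lemma has_momentsM X Y : has_moments X -> has_moments Y ->
  has_moments (fun w => X w * Y w).
Proof.
move=> [mX iX] [mY iY]; split; first exact: measurable_funM.
(* The dominating function comes from |a b| <= a^2 + b^2 with a = X^k and b = Y^k. *)
move=> k; have iXY := integrableD measurableT (iX (2 * k)%N) (iY (2 * k)%N).
apply: le_integrable iXY => //.
  by apply/measurable_EFinP/measurable_funX/measurable_funM.
move=> w _ /=; rewrite lee_fin exprMn normrM ![(2 * k)%N]mulnC !exprM.
rewrite [leRHS]ger0_norm ?addr_ge0 ?sqr_ge0//.
rewrite -[X w ^+ k ^+ 2]real_normK ?num_real//.
rewrite -[Y w ^+ k ^+ 2]real_normK ?num_real//.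
move: (normr_ge0 (X w ^+ k)) (normr_ge0 (Y w ^+ k)).
by move: `|_| `|_| => a b a0 b0; nra.
Qed.

Lemma has_moments1 : has_moments (fun=> 1).
Proof.
split=> // k; under eq_fun do rewrite expr1n.
exact: finite_measure_integrable_cst.
Qed.

Lemma has_moments_prod I (r : seq I) (p : pred I) (X : I -> T -> R) :
  (forall i, has_moments (X i)) ->
  has_moments (fun w => \prod_(i <- r | p i) X i w).
Proof.
move=> hX; elim: r => [|i r IH].
  by under eq_fun do rewrite big_nil; exact: has_moments1.
under eq_fun do rewrite big_cons.
by case: (p i) => //; exact: has_momentsM.
Qed.

Lemma has_moments_indic (A : set T) : measurable A -> has_moments \1_A.
Proof.
move=> mA; split; first exact: measurable_indic.
case=> [|k].
  by under eq_fun do rewrite expr0; exact: finite_measure_integrable_cst.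
rewrite (_ : (fun w => _) = \1_A); first exact: integrable_indic.
by apply/funext => w; rewrite indicE; case: (_ \in _); rewrite ?expr1n ?expr0n.
Qed.

Lemma has_momentsX X n : has_moments X -> has_moments (fun w => X w ^+ n).
Proof.
move=> [mX iX]; split=> [|k]; first exact: measurable_funX.
by under eq_fun do rewrite -exprM.
Qed.

End HasMoments.

Section IndependentProduct.
Local Open Scope classical_set_scope.
Context {d d' : measure_display} {T : measurableType d}
  {T' : measurableType d'} {R : realType}.
Variables (P : probability T R).

Lemma weighted_expectation (W : T -> R) (U : {RV P >-> T'}) (w : R)
    (f : T' -> R) (e : R) : has_moments P W -> has_moments P (f \o U) ->
  measurable_fun setT f ->
  (forall B, measurable B ->
    (\int[P]_x (W x * \1_B (U x))%:E = w%:E * P (U @^-1` B))%E) ->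
  (\int[P]_x (f (U x))%:E = e%:E)%E ->
  (\int[P]_x (W x * f (U x))%:E = (w * e)%:E)%E.
Proof.
move=> mW mfU mf WB fe.
have mEf : measurable_fun setT (EFin \o f) by exact/measurable_EFinP.
have iWf := has_moments_integrable (has_momentsM mW mfU).
have ifU := has_moments_integrable mfU.
rewrite (transfer_integrable (nu := distribution P U) (w := w)
  (has_moments_integrable mW) (measurable_funP U) WB)//.
- rewrite (integral_distribution mEf)//.
  by rewrite EFinM -fe.
- by apply: integrable_pushforward.
Qed.

Let integral_indicT A : measurable A -> (\int[P]_x (\1_A x)%:E = P A)%E.
Proof. by move=> mA; rewrite integral_indic// setIT. Qed.

Let measurable_preimage (U : {RV P >-> T'}) B : measurable B ->
  measurable (U @^-1` B).
Proof. by move=> mB; rewrite -[X in measurable X]setTI; exact: measurable_funP. Qed.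

Section Family.
Variables (I : finType) (U : I -> {RV P >-> T'}).
Hypothesis indU : mutual_indep_RV P (fun i => U i : T -> T').

(** Induction on the number of factors that may fail to be indicators. One such [f i] is integrated
    with the product of the others as weight; weighted transfer reduces it to an indicator, where
    the induction hypothesis applies. For indicators only, this is mutual independence. *)
Let indep_expectation_rec (n : nat) (s : {set I}) : (#|s| <= n)%N ->
  forall (f : I -> T' -> R) (e : I -> R),
  (forall i, measurable_fun setT (f i)) ->
  (forall i, has_moments P (f i \o U i)) ->
  (forall i, (\int[P]_w (f i (U i w))%:E = (e i)%:E)%E) ->
  (forall i, i \notin s -> exists2 B, measurable B & f i = \1_B) ->
  (\int[P]_w (\prod_i f i (U i w))%:E = (\prod_i e i)%:E)%E.
Proof.
elim: n s => [|n IH] s sn f e mf hf fe fB.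
  have sB i : exists B, measurable B /\ f i = \1_B.
    have /fB[B mB fiB] : i \notin s; last by exists B.
    by move: sn; rewrite leqn0 cards_eq0 => /eqP ->; rewrite inE.
  have [B mfB] := choice sB.
  have eB i : (e i)%:E = P (U i @^-1` B i).
    rewrite -fe (mfB i).2 -[RHS]integral_indicT//.
    by apply: measurable_preimage; exact: (mfB i).1.
  have := indU (J := [set: I]%SET) (B := B) (fun i _ => (mfB i).1).
  have -> : (\prod_(i in [set: I]%SET) P (U i @^-1` B i) = (\prod_i e i)%:E)%E.
    rewrite -prodEFin; apply: eq_big => [i|i _]; first by rewrite inE.
    by rewrite eB.
  move=> <-; rewrite -[RHS]integral_indicT; last first.
    apply: fin_bigcap_measurable; first exact: finite_finset.
    by move=> i _; apply: measurable_preimage; exact: (mfB i).1.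
  apply: eq_integral => w _; congr EFin; rewrite indicE.
  have [wB|wB] := pselect ((\bigcap_(i in [set` [set: I]%SET]) U i @^-1` B i) w).
    rewrite mem_set// big1// => i _; rewrite (mfB i).2 indicE mem_set//.
    by apply: wB; rewrite /= inE.
  rewrite memNset//; have [i Ui] : exists i, ~ B i (U i w).
    by apply/existsNP => Bw; apply: wB => i _; exact: Bw.
  by rewrite (bigD1 i)//= (mfB i).2 indicE memNset// mul0r.
have [s0|[i si]] := set_0Vmem s.
  by apply: (IH s) => //; rewrite s0 cards0.
pose W w := \prod_(j | j != i) f j (U j w).
pose w0 := \prod_(j | j != i) e j.
have hW : has_moments P W by apply: has_moments_prod => j; exact: hf.
under eq_integral do rewrite (bigD1 i)//= mulrC.
rewrite (bigD1 i)//= mulrC.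
apply: weighted_expectation => // B mB.
pose f' j := if j == i then \1_B else f j.
pose e' j := if j == i then fine (P (U i @^-1` B)) else e j.
have mUB : measurable (U i @^-1` B).
  exact: measurable_preimage.
have finP : P (U i @^-1` B) \is a fin_num by exact: fin_num_measure.
transitivity ((\prod_j e' j)%:E)%E; last first.
  rewrite (bigD1 i)//= /e' eqxx mulrC EFinM fineK//; congr (_%:E * _)%E.
  by apply: eq_bigr => j /negbTE ->.
rewrite -(IH (s :\ i) _ f').
- apply: eq_integral => w _; congr EFin; rewrite [RHS](bigD1 i)//= mulrC.
  rewrite /f' eqxx; congr (_ * _).
  by apply: eq_bigr => j /negbTE ->.
- by move: sn; rewrite (cardsD1 i) si.
- by move=> j; rewrite /f'; case: ifP.
- move=> j; rewrite /f'; case: eqP => [->|//].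
  exact: (has_moments_indic P mUB).
- move=> j; rewrite /f' /e'; case: eqP => [->|//].
  by rewrite fineK// -[RHS]integral_indicT.
- move=> j; rewrite /f' !inE; case: eqP => [_ _|/= _]; first by exists B.
  exact: fB.
Qed.

Lemma indep_expectation (f : I -> T' -> R) (e : I -> R) :
  (forall i, measurable_fun setT (f i)) ->
  (forall i, has_moments P (f i \o U i)) ->
  (forall i, (\int[P]_w (f i (U i w))%:E = (e i)%:E)%E) ->
  (\int[P]_w (\prod_i f i (U i w))%:E = (\prod_i e i)%:E)%E.
Proof.
move=> mf hf fe.
by apply: (indep_expectation_rec (leqnn #|[set: I]%SET|)) => // i; rewrite inE.
Qed.

End Family.
End IndependentProduct.

(** * Mixed moments of the entries of a Ginibre matrix *)

Section GinibreMoments.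
Local Open Scope classical_set_scope.
Context {d : measure_display} {T : measurableType d} {R : realType}.
Variables (P : probability T R).

Lemma gaussian_has_moments (X : {RV P >-> R}) : gaussian_law 0 2^-1 X ->
  has_moments P X.
Proof.
by move=> gX; split => // k; have [] := gaussian_moment gX k.
Qed.

(** Weighted transfer is used twice, to reduce X^a and then Y^b to indicators; what is left is
    [indep_RV2]. *)
Lemma indep2_gaussian_moment (X Y : {RV P >-> R}) (a b : nat) :
  indep_RV2 P X Y -> gaussian_law 0 2^-1 X -> gaussian_law 0 2^-1 Y ->
  (\int[P]_w (X w ^+ a * Y w ^+ b)%:E =
   (half_normal_moment a * half_normal_moment b)%:E)%E.
Proof.
move=> XY gX gY.
have hX := gaussian_has_moments gX; have hY := gaussian_has_moments gY.
have mpre (V : {RV P >-> R}) B : measurable B -> measurable (V @^-1` B).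
  by move=> mB; rewrite -[X in measurable X]setTI; exact: measurable_funP.
under eq_integral do rewrite mulrC.
rewrite mulrC.
apply: (weighted_expectation (U := X) (f := fun x => x ^+ a)).
- exact: has_momentsX.
- exact: (has_momentsX a hX).
- exact: measurable_funX.
- move=> A mA; under eq_integral do rewrite mulrC.
  have finA : P (X @^-1` A) \is a fin_num by exact: fin_num_measure (mpre X A mA).
  rewrite muleC -(fineK finA) -EFinM.
  apply: (weighted_expectation (W := \1_(X @^-1` A)) (U := Y)
    (f := fun x => x ^+ b)).
  + exact: has_moments_indic (mpre X A mA).
  + exact: (has_momentsX b hY).
  + exact: measurable_funX.
  + move=> B mB; have mAB : measurable (X @^-1` A `&` Y @^-1` B).
      by apply: measurableI; exact: mpre.
    rewrite fineK// -XY// -[X in P X]setIT -integral_indic//.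
    by apply: eq_integral => w _; rewrite !indicE in_setI -natrM mulnb.
  + exact: (gaussian_moment gY b).2.
- exact: (gaussian_moment gX a).2.
Qed.

Variables (n m : nat) (Z : T -> 'M[complex R]_(n, m)).
Hypothesis hZ : complex_ginibre P Z.

Let entryE ij : exists XY : {RV P >-> R} * {RV P >-> R},
  [/\ forall w, Z w ij.1 ij.2 = complex.Complex (XY.1 w) (XY.2 w),
      indep_RV2 P XY.1 XY.2, gaussian_law 0 2^-1 XY.1 &
      gaussian_law 0 2^-1 XY.2].
Proof. by have [X [Y H]] := hZ.1 ij.1 ij.2; exists (X, Y). Qed.

(** Mutual independence separates the entries, seen as variables in R x R; inside an entry, real and
    imaginary parts are separated by [indep2_gaussian_moment]. *)
Lemma ginibre_monomial (a b : 'I_n * 'I_m -> nat) :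
  let mono w := \prod_ij (complex.Re (Z w ij.1 ij.2) ^+ a ij *
                       complex.Im (Z w ij.1 ij.2) ^+ b ij) in
  has_moments P mono /\
  (\int[P]_w (mono w)%:E =
   (\prod_ij (half_normal_moment (a ij) * half_normal_moment (b ij)))%:E)%E.
Proof.
move=> mono.
have mpair ij : measurable_fun setT (fun w => complex_pair (Z w ij.1 ij.2)).
  have [[X Y] [ZE _ _ _]] := entryE ij.
  rewrite (_ : (fun w => _) = (fun w => (X w, Y w))).
    by apply: measurable_fun_pair.
  by apply/funext => w; rewrite ZE.
pose U ij : {RV P >-> (R * R)%type} :=
  MeasurableFun.Pack (MeasurableFun.Class (isMeasurableFun.Build _ _ _ _ _ (mpair ij))).
pose f ij (z : R * R) := z.1 ^+ a ij * z.2 ^+ b ij.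
have hf ij : has_moments P (f ij \o U ij).
  have [[X Y] [ZE _ gX gY]] := entryE ij.
  rewrite (_ : f ij \o U ij = (fun w => X w ^+ a ij * Y w ^+ b ij)).
    by apply: has_momentsM; apply: has_momentsX; exact: gaussian_has_moments.
  by apply/funext => w; rewrite /f /= /complex_pair ZE.
have hM : has_moments P mono by apply: has_moments_prod => ij; exact: hf.
split=> //; apply: (@indep_expectation _ _ _ _ _ P _ U hZ.2 f) => //.
- by move=> ij; apply: measurable_funM; apply: measurable_funX;
    [exact: measurable_fst|exact: measurable_snd].
- move=> ij; have [[X Y] [ZE XY gX gY]] := entryE ij.
  rewrite -(indep2_gaussian_moment _ _ XY gX gY); apply: eq_integral => w _.
  by rewrite /f /= /complex_pair ZE.
Qed.

End GinibreMoments.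

(** * Gaussian expectation of polynomials *)

Section WickFunctional.

Variables (R : realType) (N : nat).
Local Notation C := (complex R).
Local Notation MP := (mpoly N C).

Lemma half_normal_momentS k : half_normal_moment k.+1 =
  k%:R / 2 * half_normal_moment k.-1 :> R.
Proof. by case: k => [|k] //=; rewrite !mul0r. Qed.

Definition wick_weight (mn : multinom N) : R :=
  \prod_k half_normal_moment (mn k).

(* The expectation of [u] evaluated at independent centered Gaussians of
   variance 1/2. *)
Definition wick (u : MP) : C :=
  \sum_(mn <- msupp u) mcoeff mn u * real_complex R (wick_weight mn).

(** A range of summation that does not depend on the support of u makes linearity a termwise
    matter. *)
Lemma wickE k (u : MP) : (mmeasure mdeg u <= k)%N -> wick u =
  \sum_(mn : bmultinom N k) mcoeff mn u * real_complex R (wick_weight mn).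
Proof.
move=> uk; rewrite /wick (big_mksub (bmultinom N k)) ?msupp_uniq//=; last first.
  by move=> mn /msize_mdeg_lt /leq_trans; apply.
by rewrite big_rmcond//= => mn /memN_msupp_eq0 ->; rewrite mul0r.
Qed.

Lemma wickD : {morph wick : u v / u + v}.
Proof.
move=> u v; pose k := maxn (mmeasure mdeg (u + v))
  (maxn (mmeasure mdeg u) (mmeasure mdeg v)).
rewrite !(@wickE k) ?leq_max ?leqnn ?orbT// -big_split.
by apply: eq_bigr => mn _; rewrite mcoeffD mulrDl.
Qed.

Lemma wickZ (c : C) u : wick (c *: u) = c * wick u.
Proof.
pose k := maxn (mmeasure mdeg (c *: u)) (mmeasure mdeg u).
rewrite !(@wickE k) ?leq_max ?leqnn ?orbT// mulr_sumr.
by apply: eq_bigr => mn _; rewrite mcoeffZ mulrA.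
Qed.

Lemma wickX mn : wick (mpolyX C mn) = real_complex R (wick_weight mn).
Proof. by rewrite /wick msuppX big_seq1 mcoeffX eqxx mul1r. Qed.

Lemma wick1 : wick 1 = 1.
Proof.
rewrite -mpolyX0 wickX /wick_weight big1// => k _.
by rewrite mnm0E.
Qed.

Lemma wick_sum I (r : seq I) (E : I -> MP) :
  wick (\sum_(i <- r) E i) = \sum_(i <- r) wick (E i).
Proof.
by apply: (big_morph wick wickD); rewrite -(scale0r 0) wickZ mul0r.
Qed.

(** On monomials this is [half_normal_momentS]; the factor 1/2 is the variance. *)
Lemma wick_ibp v u : wick (mpolyX C (mnm1 v) * u) = 2^-1 * wick (mderiv v u).
Proof.
rewrite [X in wick (_ * X)]mpolyE [X in mderiv v X]mpolyE mulr_sumr raddf_sum.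
rewrite !wick_sum mulr_sumr.
apply: eq_bigr => mn _.
rewrite /= -scalerAr mderivZ !wickZ /= mulrCA; congr (_ * _).
rewrite -mpolyXD wickX mderivX wickZ wickX.
(* If [mn v] is 0 both sides vanish, so the truncated subtraction is harmless. *)
have -> : wick_weight (mnm_add (mnm1 v) mn) =
    (mn v)%:R / 2 * wick_weight (mnm_sub mn (mnm1 v)).
  rewrite /wick_weight (bigD1 v)//= [in RHS](bigD1 v)//= mulrA.
  rewrite mnmDE mnmBE mnm1E eqxx add1n subn1 half_normal_momentS; congr (_ * _).
  apply: eq_bigr => w wv.
  by rewrite mnmDE mnmBE mnm1E eq_sym (negbTE wv) add0n subn0.
rewrite mulrAC rmorphM mulrC rmorphM fmorphV !rmorph_nat.
by rewrite mulrA.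
Qed.

End WickFunctional.

(** * Gram moments as polynomials in the real and imaginary parts of the entries *)

Section PolynomialGinibre.
Local Open Scope sesquilinear_scope.

Variables (R : realType) (n m : nat).
Local Notation C := (complex R).
Local Notation V := ('I_n * 'I_m * bool)%type.
Local Notation MP := (mpoly #|{: V}| C).
Local Notation ii := (complex.Complex 0 1 : C).

(* [false] indexes the real parts of the entries and [true] the imaginary ones. *)
Let var (i : 'I_n) (j : 'I_m) (b : bool) : MP :=
  mpolyX C (mnm1 (enum_rank (i, j, b))).

Let Zp : 'M[MP]_(n, m) := \matrix_(i, j) (var i j false + ii *: var i j true).
Let Zps : 'M[MP]_(m, n) := \matrix_(j, i) (var i j false - ii *: var i j true).

(** The Wirtinger derivative (d/dx - i d/dy) / 2 in the entry x + i y; it kills x - i y. *)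
Let D (i : 'I_n) (j : 'I_m) (u : MP) : MP :=
  2^-1 *: (mderiv (enum_rank (i, j, false)) u
           - ii *: mderiv (enum_rank (i, j, true)) u).

Let ii2 : ii * ii = -1.
Proof. exact: (sqr_i R). Qed.

Let mderiv_var i j b a c e : mderiv (enum_rank (i, j, b)) (var a c e) =
  ((a == i) && (c == j) && (e == b))%:R.
Proof.
rewrite /var mderivX mnm1E (inj_eq enum_rank_inj) !xpair_eqE.
case: (boolP (_ && _ && _)) => [/andP[/andP[/eqP -> /eqP ->] /eqP ->]|_].
  by rewrite scale1r (_ : mnm_sub _ _ = mnm0) ?mpolyX0//; apply/mnmP => k;
    rewrite mnmBE mnm0E subnn.
by rewrite scale0r.
Qed.

Let DD i j : {morph D i j : u v / u + v}.
Proof.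
by move=> u v; rewrite /D !mderivD -[RHS]scalerDr [ii *: _]scalerDr opprD addrACA.
Qed.

Let DM i j u v : D i j (u * v) = D i j u * v + u * D i j v.
Proof.
rewrite /D !mderivM -scalerAl -scalerAr -[RHS]scalerDr; congr (_ *: _).
by rewrite mulrBl mulrBr scalerDr opprD addrACA scalerAl scalerAr.
Qed.

Let DZ i j a b : D i j (Zp a b) = ((a == i) && (b == j))%:R.
Proof.
rewrite /D mxE !mderivD !mderivZ !mderiv_var eqxx !andbT !andbF /=.
rewrite scaler0 addr0 add0r scalerA ii2 scaleN1r opprK.
rewrite scalerDr -scalerDl (_ : 2^-1 + 2^-1 = 1) ?scale1r//.
by rewrite -mulr2n -[LHS]mulr_natr mulVf ?pnatr_eq0.
Qed.

Let DZs i j b a : D i j (Zps b a) = 0.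
Proof.
rewrite /D mxE !mderivB !mderivZ !mderiv_var eqxx !andbT !andbF /=.
by rewrite scaler0 subr0 sub0r scalerN scalerA ii2 scaleN1r opprK subrr scaler0.
Qed.

Let wickN (u : MP) : wick (- u) = - wick u.
Proof. by rewrite -scaleN1r wickZ mulN1r. Qed.

Let LIBP i j u : wick (Zps j i * u) = wick (D i j u).
Proof.
rewrite mxE mulrBl wickD wickN -scalerAl wickZ !wick_ibp /D wickZ wickD wickN.
by rewrite wickZ mulrBr mulrCA.
Qed.

Lemma wick_trace_moment p :
  wick (\tr ((Zp *m Zps) ^+ p.+1)) = wmoment n%:R m%:R p.+1.
Proof.
exact: (gaussian_trace_moment DD DM DZ DZs (@wickD R _) (@wickZ R _)
  (@wick1 R _) LIBP).
Qed.

Let rho (A : 'M[C]_(n, m)) (k : 'I_#|{: V}|) : R :=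
  let: (i, j, b) := enum_val k in
  if b then complex.Im (A i j) else complex.Re (A i j).

Let ev (A : 'M[C]_(n, m)) : MP -> C := meval (fun k => real_complex R (rho A k)).

Let ev_var A i j b : ev A (var i j b) =
  real_complex R (if b then complex.Im (A i j) else complex.Re (A i j)).
Proof. by rewrite /ev mevalXU /rho enum_rankK. Qed.

Let ev_Zp A : map_mx (ev A) Zp = A.
Proof.
apply/matrixP => i j; rewrite !mxE /ev mevalD mevalZ -/(ev A) !ev_var.
by rewrite [RHS]complexE.
Qed.

Let ev_Zps A : map_mx (ev A) Zps = A ^t*.
Proof.
apply/matrixP => i j; rewrite !mxE /ev mevalB mevalZ -/(ev A) !ev_var.
case: (A j i) => x y; apply/eqP; rewrite eq_complex /=.
by apply/andP; split; apply/eqP; ring.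
Qed.

Lemma gram_moment_ev A p :
  gram_moment A p = n%:R^-1 * ev A (\tr ((Zp *m Zps) ^+ p)).
Proof.
rewrite /gram_moment /ntr; congr (_ * _).
rewrite /ev -trace_map_mx; congr (\tr _).
elim: p => [|p IH]; first by rewrite !expr0 [RHS]map_mx1.
rewrite !exprS -!mulmxE [RHS]map_mxM -IH; congr (_ *m _).
by rewrite [RHS]map_mxM -/(ev A) ev_Zp ev_Zps.
Qed.


Let exps (mn : multinom #|{: V}|) (b : bool) (ij : 'I_n * 'I_m) : nat :=
  mn (enum_rank (ij, b)).

Let prod_vars (E : V -> R) :
  \prod_(k < #|{: V}|) E (enum_val k) = \prod_ij (E (ij, false) * E (ij, true)).
Proof.
transitivity (\prod_(v : V) E v).
  rewrite [RHS](reindex_onto (fun k : 'I_#|{: V}| => enum_val k) enum_rank) /=.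
    by apply: eq_bigl => k; rewrite enum_valK eqxx.
  by move=> v _; rewrite enum_rankK.
rewrite (eq_bigr (fun v : V => E (v.1, v.2))); last by case.
rewrite -(pair_bigA _ (fun ij b => E (ij, b))) /=.
by apply: eq_bigr => ij _; rewrite big_bool mulrC.
Qed.

Let rho_monomial A (mn : multinom #|{: V}|) : \prod_k rho A k ^+ mn k =
  \prod_ij (complex.Re (A ij.1 ij.2) ^+ exps mn false ij *
            complex.Im (A ij.1 ij.2) ^+ exps mn true ij).
Proof.
have /= <- := prod_vars (fun v => (if v.2 then complex.Im (A v.1.1 v.1.2)
   else complex.Re (A v.1.1 v.1.2)) ^+ mn (enum_rank v)).
apply: eq_bigr => k _; rewrite enum_valK /rho.
by case: (enum_val k) => [[i j] b].
Qed.

Let wick_weight_prod (mn : multinom #|{: V}|) : wick_weight R mn =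
  \prod_ij (half_normal_moment (exps mn false ij) *
            half_normal_moment (exps mn true ij)).
Proof.
have /= <- := prod_vars (fun v => half_normal_moment (mn (enum_rank v))).
by apply: eq_bigr => k _; rewrite enum_valK.
Qed.

Let ReM_real (c : C) (x : R) :
  complex.Re (c * real_complex R x) = complex.Re c * x.
Proof. by case: c => a b /=; rewrite mulr0 subr0. Qed.

Let Re_sum I (r : seq I) (E : I -> C) :
  complex.Re (\sum_(i <- r) E i) = \sum_(i <- r) complex.Re (E i).
Proof. by apply: (big_morph (@complex.Re R)) => // -[a b] [a' b']. Qed.

(** The Gram moment is a polynomial with complex coefficients in real variables, so taking real
    parts affects the coefficients only. Each monomial has expectation [wick_weight], and the sum is
    the real part of [wick]. *)
Lemma expectation_gram_moment (d : measure_display) (T : measurableType d)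
    (P : probability T R) (Z : T -> 'M[C]_(n, m)) (p : nat) :
  complex_ginibre P Z -> (0 < p)%N ->
  ('E_P[fun w => complex.Re (gram_moment (Z w) p)] =
   (n%:R^-1 * wmoment n%:R m%:R p)%:E)%E.
Proof.
case: p => // p hZ _; set F := \tr ((Zp *m Zps) ^+ p.+1).
pose c mn : R := complex.Re (n%:R^-1 * mcoeff mn F).
have gE w : complex.Re (gram_moment (Z w) p.+1) =
    \sum_(mn <- msupp F) c mn * \prod_k rho (Z w) k ^+ mn k.
  rewrite gram_moment_ev -/F /ev mevalE mulr_sumr Re_sum.
  apply: eq_bigr => mn _; rewrite mulrA -ReM_real; congr (complex.Re (_ * _)).
  by rewrite rmorph_prod; apply: eq_bigr => k _; rewrite rmorphXn.
have mom (mn : multinom #|{: V}|) : has_moments P (fun w => \prod_k rho (Z w) k ^+ mn k) /\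
    (\int[P]_w (\prod_k rho (Z w) k ^+ mn k)%:E = (wick_weight R mn)%:E)%E.
  under [X in has_moments _ X]eq_fun do rewrite rho_monomial.
  under eq_integral do rewrite rho_monomial.
  by rewrite wick_weight_prod; exact: ginibre_monomial.
rewrite unlock; under eq_integral do rewrite gE -sumEFin.
rewrite integral_sum//; last first.
  move=> mn; under eq_fun do rewrite EFinM.
  by apply: integrableZl => //; exact: has_moments_integrable (mom mn).1.
under eq_bigr => mn _.
  under eq_integral do rewrite EFinM.
  rewrite integralZl//; last exact: has_moments_integrable (mom mn).1.
  rewrite (mom mn).2 -EFinM.
  over.
rewrite sumEFin; congr EFin.
transitivity (complex.Re (n%:R^-1 * wick F)).
  rewrite /wick mulr_sumr Re_sum; apply: eq_bigr => mn _.
  by rewrite mulrA ReM_real.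
rewrite wick_trace_moment.
(* The complex value is real, as [wmoment] commutes with the embedding of the reals. *)
have wC : wmoment n%:R m%:R p.+1 =
    real_complex R (wmoment n%:R m%:R p.+1) :> C.
  by rewrite rmorph_wmoment !rmorph_nat.
by rewrite wC ReM_real; congr (_ * _); rewrite -(rmorph_nat (real_complex R)) -fmorphV.
Qed.

End PolynomialGinibre.

Theorem theorem5p1 (R : realType) :
  exists2 K : R, 0 < K &
  forall (n m : nat), (0 < n)%N -> (n <= m)%N ->
  forall (d : measure_display) (T : measurableType d) (P : probability T R)
    (Z : T -> 'M[complex R]_(n, m)),
  complex_ginibre P Z ->
  forall p : nat, (1 <= p)%N ->
  let c : R := m%:R / n%:R in
  ('E_P[fun w => complex.Re (gram_moment (Z w) p)] <=
   (K * n%:R ^+ p * (Num.sqrt c + 1) ^+ (2 * p) *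
    (1 + 2 * p%:R ^+ 2 / (c `^ (3 / 2) * n%:R ^+ 2)) ^+ p *
    (c `^ (3 / 4) / p%:R `^ (3 / 2)))%:E)%E.
Proof.
exists 10 => // n m n0 nm d T P Z hZ p p0.
by rewrite /= (expectation_gram_moment hZ p0) lee_fin; exact: wmoment_bound.
Qed.
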